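(* Let $\mu,\nu\in\mathcal P_1(\mathbb R)$ and $\beta\in[0,1)$. Then $\mathrm{Cpl}_\beta(\mu,\nu)\neq\emptyset$ if and only if $\mu\prec_\beta\nu$.
   Context: $\mathcal P_1(\mathbb R)$ is the set of Borel probability measures on $\mathbb R$ with finite first moment. For a measure $\rho$ on $\mathbb R$, $\{\max\mathrm{supp}(\rho)\}$ is understood to be the empty set if $\mathrm{supp}(\rho)$ is not bounded above (so its $\rho$-mass is then $0$). $\beta$-biased martingales: a martingale $(X_t)_{t=0,1}$ on some stochastic basis $(\Omega,\mathcal F,\mathbb P,(\mathcal F_t)_{t=0,1})$ is called $\beta$-biased if, $\mathbb P$-almost surely, the conditional law $\rho=\mathrm{Law}(X_1\mid\mathcal F_0)$ satisfies $\rho(\{\max\mathrm{supp}(\rho)\})\ge\beta$. (The $\sigma$-algebra $\mathcal F_0$ may be larger than $\sigma(X_0)$. For $\beta=0$ the condition is void.) $\mathrm{Cpl}_\beta(\mu,\nu)$ denotes the set of all laws $\mathrm{Law}(X_0,X_1)$ of $\beta$-biased martingales (on arbitrary stochastic bases) with $X_0\sim\mu$ and $X_1\sim\nu$. $\beta$-biased order: for a continuous $g:\mathbb R\to\mathbb R$ with $|g(x)|\le C(1+|x|)$ for some $C>0$ (a continuous linearly bounded function), its $\beta$-envelope is $$g_\beta(x):=\inf\Big\{\int g\,d\rho:\ \rho\in\mathcal P_1(\mathbb R),\ \int y\,\rho(dy)=x,\ \rho(\{\max\mathrm{supp}(\rho)\})\ge\beta\Big\}\in[-\infty,\infty).$$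 One writes $\mu\prec_\beta\nu$ if $\int g_\beta\,d\mu\le\int g\,d\nu$ for all continuous linearly bounded $g:\mathbb R\to\mathbb R$. *)

(* Defs.v *)
From HB Require Import structures.
From mathcomp Require Import all_boot all_order all_algebra.
From mathcomp Require Import all_classical all_reals all_analysis.

Set Implicit Arguments.
Unset Strict Implicit.
Unset Printing Implicit Defensive.

Import Order.TTheory GRing.Theory Num.Theory.
Import numFieldNormedType.Exports.

Local Open Scope classical_set_scope.
Local Open Scope ring_scope.
Local Open Scope ereal_scope.

Section measures_on_the_line.
Context {R : realType}.
Implicit Types (rho : {measure set R -> \bar R}) (beta x : R).

Definition finite_first_moment rho := rho.-integrable setT (EFin : R -> \bar R).

Definition supp rho : set R :=
  [set x | forall U : set R, open_nbhs x U -> 0 < rho U].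

(* {max supp rho}: a singleton when supp rho has a greatest element, and empty
   otherwise, in particular when supp rho is not bounded above. *)
Definition max_supp rho : set R := supp rho `&` ubound (supp rho).

Definition biased beta rho := beta%:E <= rho (max_supp rho).

Definition has_mean rho x := \int[rho]_y y%:E = x%:E.

End measures_on_the_line.

Section biased_order.
Context {R : realType}.
Implicit Types (g : R -> R) (beta x : R) (mu nu : probability R R).

Definition linearly_bounded g :=
  exists2 C : R, (0 < C)%R & forall x, (`|g x| <= C * (1 + `|x|))%R.

Definition envelope beta g x : \bar R :=
  ereal_inf [set \int[rho]_y (g y)%:E | rho in
    [set rho : probability R R |
      [/\ finite_first_moment rho, has_mean rho x & biased beta rho]]].

(* The envelope is upper semicontinuous, as an infimum over the centred rho of
   the continuous maps x |-> \int g(y + x) rho(dy), and it is bounded above by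
   g; its integral below is thus well defined in [-oo, +oo). *)
Definition biased_le beta mu nu :=
  forall g, continuous g -> linearly_bounded g ->
    \int[mu]_x envelope beta g x <= \int[nu]_x (g x)%:E.

End biased_order.

Section biased_martingales.
Context d {Omega : measurableType d} {R : realType}.
Implicit Types (P : probability Omega R) (F : set (set Omega)).
Implicit Types (X Y : Omega -> R) (beta : R).

Definition sub_sigma_algebra F := sigma_algebra setT F /\ F `<=` measurable.

Definition measurable_wrt F X :=
  measurable_fun setT (X : g_sigma_algebraType F -> R).

Definition is_cond_expectation P F X Y :=
  [/\ measurable_wrt F Y, P.-integrable setT (EFin \o Y) &
      forall A, F A -> \int[P]_(w in A) (Y w)%:E = \int[P]_(w in A) (X w)%:E].

Definition is_cond_law P F X (k : R.-pker (g_sigma_algebraType F) ~> R) :=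
  forall A B, F A -> measurable B ->
    P (A `&` X @^-1` B) = \int[P]_(w in A) k w B.

Record martingale P F0 F1 X0 X1 : Prop := {
  martingale_sub0 : sub_sigma_algebra F0 ;
  martingale_sub1 : sub_sigma_algebra F1 ;
  martingale_filtration : F0 `<=` F1 ;
  martingale_adapted0 : measurable_wrt F0 X0 ;
  martingale_adapted1 : measurable_wrt F1 X1 ;
  martingale_integrable0 : P.-integrable setT (EFin \o X0) ;
  martingale_integrable1 : P.-integrable setT (EFin \o X1) ;
  martingale_cond : is_cond_expectation P F0 X1 X0 }.

(* Regular conditional laws of real random variables exist and are unique up to
   P-null sets, so asking the bias of one version or of all is the same. *)
Definition biased_martingale beta P F0 F1 X0 X1 :=
  martingale P F0 F1 X0 X1 /\
  exists2 k : R.-pker (g_sigma_algebraType F0) ~> R,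
    is_cond_law P X1 k & {ae P, forall w, biased beta (k w)}.

Definition has_law d' (T : measurableType d') P (X : Omega -> T)
    (m : probability T R) :=
  forall B, measurable B -> pushforward P X B = m B.

End biased_martingales.

Definition Cpl {R : realType} (beta : R) (mu nu : probability R R) :
    set (probability (R * R)%type R) :=
  [set pi | exists (d : measure_display) (Omega : measurableType d)
      (P : probability Omega R) (F0 F1 : set (set Omega)) (X0 X1 : Omega -> R),
    [/\ biased_martingale beta P F0 F1 X0 X1, has_law P X0 mu, has_law P X1 nu
      & has_law P (fun w => (X0 w, X1 w)) pi]].

(* Main.v *)
(* Given a biased martingale, the conditional law of [X1] is a competitor in the
   envelope of [g] at [X0], and integrating gives the inequality of the order.

   Conversely, a biased martingale amounts to a law of four variables
   [(x, m, y, e)], where [m] is the maximum of the support of the conditional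
   law of [y] and [e] in [0, 1] vanishes off [y = m], such that [y <= m] and,
   given [(x, m)], [y] has mean [x] and [e] has mean [beta]. The least cost
   [\int a dmu + \int g dnu] of functions [a(x) + g(y)] which dominate [F] up to
   terms [s(x, m) (y - x) + t(x, m) (e - beta)] is a sublinear functional of [F],
   and [mu <_beta nu] says that it is not degenerate. A linear functional below
   it (Hahn-Banach) has marginals [mu] and [nu], which makes it tight, hence a
   Daniell integral; under the measure it defines, the multipliers [s] and [t]
   become the two conditional mean equations. Conditioning on [(x, m)] then
   turns [e] into an atom of mass at least [beta] at the maximum. *)

Require Import Defs.
From HB Require Import structures.
From mathcomp Require Import all_boot all_order all_algebra.
From mathcomp Require Import all_classical all_reals all_analysis.
From mathcomp Require Import measurable_realfun ring lra.
Set Implicit Arguments.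
Unset Strict Implicit.
Unset Printing Implicit Defensive.
Import Order.TTheory GRing.Theory Num.Theory.
Import numFieldNormedType.Exports.
Local Open Scope classical_set_scope.
Local Open Scope ring_scope.

(** * Linear functionals below a sublinear one *)

(** The obstacle is that the bias condition is not convex: a mixture of biased laws need not be
    biased. It can thus neither be dualized directly nor be obtained by conditioning on the starting
    point alone. Recording [m] and [e] turns it into a support condition and two conditional means,
    which are linear in the joint law. The price is a coordinate [m] that no marginal controls. Its
    tightness comes from the bias itself: on admissible points [e |m| = e |y| <= |y|], and [e] has
    mean [beta], so the mean of [|m|] is at most that of [|y|] divided by [beta]. This is the origin
    of every [1 / beta] in the costs. The argument breaks down at [beta = 0], where there is no bias
    to record and [m] and [e] are frozen at 0. Nondegeneracy is checked for fixed [(x, m)] by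
    integrating in [y] alone, so the multipliers may be arbitrary functions. No topology on measures
    is used: a linear functional on continuous functions of linear growth is built, and Dini's
    theorem on boxes supplies the monotone continuity that Daniell's construction requires. *)

Section hahn_banach.
Context {R : realType} {V : lmodType R}.
Variable E : set V.
Hypothesis ED : forall u v, E u -> E v -> E (u + v).
Hypothesis EZ : forall (c : R) u, E u -> E (c *: u).
Hypothesis E_0 : E 0.

(** The inequality for positive [c] suffices: applied to [c^-1] it gives the reverse one, and
    [q 0 = 0] follows. Everything is relative to a subspace [E], since the superhedging cost is
    controlled only for functions of linear growth. *)
Definition sublinear_on (q : V -> R) :=
  (forall u v, E u -> E v -> q (u + v) <= q u + q v) /\
  (forall (c : R) u, 0 < c -> E u -> q (c *: u) <= c * q u).

Definition linear_on (q : V -> R) :=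
  (forall u v, E u -> E v -> q (u + v) = q u + q v) /\
  (forall (c : R) u, E u -> q (c *: u) = c * q u).

Let EN u : E u -> E (- u).
Proof. by rewrite -scaleN1r; exact: EZ. Qed.

Let sublinear_onZ q c u : sublinear_on q -> 0 < c -> E u -> q (c *: u) = c * q u.
Proof.
move=> [_ qZ] c0 Eu; apply/eqP; rewrite eq_le qZ//=.
have c'0 : 0 < c^-1 by rewrite invr_gt0.
have := qZ _ _ c'0 (EZ c Eu).
by rewrite scalerA mulVf ?gt_eqF// scale1r -ler_pdivlMl ?invrK.
Qed.

Let sublinear_on0 q : sublinear_on q -> q 0 = 0.
Proof.
move=> sq; have := sublinear_onZ sq (ltr0Sn R 1) E_0.
by rewrite scaler0 => /eqP; rewrite -subr_eq0 => /eqP; lra.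
Qed.

Let sublinear_onN q u : sublinear_on q -> E u -> - q (- u) <= q u.
Proof.
move=> sq Eu; have [qD _] := sq.
have := qD u (- u) Eu (EN Eu); rewrite subrr (sublinear_on0 sq); lra.
Qed.

(** The value 0 is imposed off [E] so that a functional is determined by its restriction to [E] and
    minimality can be an equality of functions on [V]. *)
Let below q (p : V -> R) :=
  [/\ sublinear_on p, forall u, E u -> p u <= q u & forall u, ~ E u -> p u = 0].

(** Zorn's lemma for the reversed pointwise order: the pointwise infimum of a nonempty chain is
    again sublinear and below [q]. *)
Let minimal_sublinear q : sublinear_on q ->
  exists2 p, below q p &
    forall p', below q p' -> (forall u, p' u <= p u) -> p' = p.
Proof.
move=> sq.
pose T := {p : V -> R | below q p}.
pose ord : rel T := fun p p' => `[< forall u, sval p' u <= sval p u >].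
have q0 : below q (fun u => if pselect (E u) then q u else 0).
  split; first split.
  - move=> u v Eu Ev; have Euv := ED Eu Ev.
    by repeat case: pselect => // ?; exact: sq.1.
  - move=> c u c0 Eu; have Ecu := EZ c Eu.
    by repeat case: pselect => // ?; exact: sq.2.
  - by move=> u Eu; case: pselect.
  - by move=> u Eu; case: pselect.
have [||||t tmin] := @Zorn T ord.
- by move=> t; apply/asboolP.
- move=> r s t /asboolP rs /asboolP st; apply/asboolP => u.
  exact: le_trans (st u) (rs u).
- move=> [s bs] [t bt] /asboolP /= st /asboolP /= ts; apply: eq_exist => /=.
  by apply/funext => u; apply/eqP; rewrite eq_le ts st.
- move=> A totA.
  have [[s0 As0]|A0] := pselect (A !=set0); last first.
    by exists (exist _ _ q0) => s As; exfalso; apply: A0; exists s.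
  pose S u := [set sval s u | s in A].
  have S0 u : S u !=set0 by exists (sval s0 u), s0.
  (* A bound common to all members of the chain, which keeps the infimum finite. *)
  have lbS u : E u -> lbound (S u) (- q (- u)).
    move=> Eu _ [s As <-]; have [ss sle _] := svalP s.
    apply: le_trans (sublinear_onN ss Eu); rewrite lerN2.
    exact/sle/EN.
  have infle s u : A s -> E u -> inf (S u) <= sval s u.
    by move=> As Eu; apply: ge_inf; [exists (- q (- u)); exact: lbS|exists s].
  have b : below q (fun u => inf (S u)).
    split; first split.
    + move=> u v Eu Ev.
      rewrite -lerBlDr; apply: lb_le_inf => // _ [s As <-].
      rewrite lerBlDr [leRHS]addrC -lerBlDr; apply: lb_le_inf => // _ [t At <-].
      rewrite lerBlDr.
      (* The infima at [u] and [v] are approached by different members of the chain; the smaller of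
         the two serves for both. *)
      have [/asboolP le|/asboolP le] := totA _ _ As At.
      * apply: (le_trans (infle _ _ At (ED Eu Ev))).
        have [[tD _] _ _] := svalP t; apply: (le_trans (tD _ _ Eu Ev)).
        by rewrite addrC lerD2l.
      * apply: (le_trans (infle _ _ As (ED Eu Ev))).
        have [[sD _] _ _] := svalP s; apply: (le_trans (sD _ _ Eu Ev)).
        by rewrite addrC lerD2r.
    + move=> c u c0 Eu; rewrite -ler_pdivrMl//.
      apply: lb_le_inf => // _ [s As <-]; rewrite ler_pdivrMl//.
      have [[_ sZ] _ _] := svalP s.
      exact: le_trans (infle _ _ As (EZ c Eu)) (sZ _ _ c0 Eu).
    + move=> u Eu; have [_ sle _] := svalP s0.
      exact: le_trans (infle _ _ As0 Eu) (sle _ Eu).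
    + move=> u nEu; have -> : S u = [set 0].
        apply/seteqP; split => [_ [s As <-]|_ ->].
          by have [_ _ ->] := svalP s.
        by exists s0 => //; have [_ _ ->] := svalP s0.
      by rewrite inf1.
  exists (exist _ _ b) => s As; apply/asboolP => u /=.
  have [Eu|nEu] := pselect (E u); first exact: infle.
  by have [_ _ ->] := b => //; have [_ _ ->] := svalP s.
exists (sval t); first exact: svalP.
move=> p' bp' p't.
have : exist _ p' bp' = t by apply: tmin; apply/asboolP.
by move=> <-.
Qed.

(* A minimal sublinear functional [p] is linear: for every [v], the functional
   [u |-> inf_(t >= 0) (p (u + t v) - t p v)] is sublinear and below [p]. *)
Lemma hahn_banach q : sublinear_on q ->
  exists2 L, linear_on L & forall u, E u -> L u <= q u.
Proof.
move=> sq; have [p [sp ple p0] pmin] := minimal_sublinear sq.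
have [pD pZ] := sp.
have pZ0 t v : 0 <= t -> E v -> p (t *: v) = t * p v.
  rewrite le_eqVlt => /predU1P[<-|t0] Ev.
    by rewrite scale0r mul0r sublinear_on0.
  exact: sublinear_onZ.
have padd u v : E u -> E v -> p u + p v <= p (u + v).
  move=> Eu Ev.
  pose S w := [set p (w + t *: v) - t * p v | t in [set t | 0 <= t]].
  have S0 w : S w !=set0 by exists (p (w + 0 *: v) - 0 * p v), 0; rewrite /=.
  have lbS w : E w -> lbound (S w) (- p (- w)).
    move=> Ew _ [t t0 <-]; rewrite -(pZ0 _ _ t0 Ev).
    have := pD (w + t *: v) (- w) (ED Ew (EZ t Ev)) (EN Ew).
    rewrite addrAC subrr add0r; lra.
  have infle t w : 0 <= t -> E w -> inf (S w) <= p (w + t *: v) - t * p v.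
    by move=> t0 Ew; apply: ge_inf; [exists (- p (- w)); exact: lbS|exists t].
  pose p' w := if pselect (E w) then inf (S w) else 0.
  have p'S w : E w -> p' w = inf (S w) by rewrite /p'; case: pselect.
  have p'p w : p' w <= p w.
    rewrite /p'; case: pselect => [Ew|nEw]; last by rewrite p0.
    by have := infle 0 w (lexx _) Ew; rewrite scale0r mul0r addr0 subr0.
  have p'E : p' = p.
    apply: pmin => //; split; last by move=> w nEw; rewrite /p'; case: pselect.
      split.
      - move=> w1 w2 Ew1 Ew2; have Ew := ED Ew1 Ew2; rewrite !p'S//.
        rewrite -lerBlDr; apply: lb_le_inf => // _ [t t0 <-].
        rewrite lerBlDr [leRHS]addrC -lerBlDr; apply: lb_le_inf => // _ [t' t0' <-].
        rewrite lerBlDr; apply: (le_trans (infle (t + t') _ (addr_ge0 t0 t0') Ew)).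
        have := pD (w1 + t *: v) (w2 + t' *: v) (ED Ew1 (EZ t Ev)) (ED Ew2 (EZ t' Ev)).
        rewrite addrACA -scalerDl; lra.
      - move=> c w c0 Ew; have Ecw := EZ c Ew; rewrite !p'S//.
        rewrite -ler_pdivrMl//; apply: lb_le_inf => // _ [t t0 <-].
        rewrite ler_pdivrMl//.
        apply: (le_trans (infle (c * t) _ (mulr_ge0 (ltW c0) t0) Ecw)).
        rewrite -scalerA -scalerDr mulrBr mulrA lerD2r.
        by apply: pZ => //; apply: ED => //; exact: EZ.
    by move=> w Ew; apply: (le_trans (p'p w)); exact: ple.
  have : p' u <= p (u + v) - p v.
    by rewrite p'S//; have := infle 1 u ler01 Eu; rewrite scale1r mul1r.
  by rewrite p'E; lra.
have paddE u v : E u -> E v -> p (u + v) = p u + p v.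
  by move=> Eu Ev; apply/eqP; rewrite eq_le pD// padd.
have pN u : E u -> p (- u) = - p u.
  move=> Eu; have := paddE _ _ Eu (EN Eu); rewrite subrr (sublinear_on0 sp); lra.
exists p => //; split => // c u Eu.
have [c0|c0] := leP 0 c; first exact: pZ0.
have c0' : 0 <= - c by rewrite oppr_ge0 ltW.
by have := pZ0 _ _ c0' Eu; rewrite scaleNr pN ?mulNr; [lra|exact: EZ].
Qed.

End hahn_banach.

(** * Daniell integrals *)

Section daniell.
Context {R : realType} {T : pointedType}.
Variables (E : set (T -> R)) (L : (T -> R) -> R).
Hypothesis E1 : E (cst 1).
Hypothesis ED : forall f g, E f -> E g -> E (fun x => f x + g x).
Hypothesis EZ : forall (c : R) f, E f -> E (fun x => c * f x).
Hypothesis Emin : forall f g, E f -> E g -> E (fun x => Num.min (f x) (g x)).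
Hypothesis L1 : L (cst 1) = 1.
Hypothesis LD : forall f g, E f -> E g -> L (fun x => f x + g x) = L f + L g.
Hypothesis LZ : forall (c : R) f, E f -> L (fun x => c * f x) = c * L f.
Hypothesis Lge0 : forall f, E f -> (forall x, 0 <= f x) -> 0 <= L f.
Hypothesis Lcvg0 : forall f : nat -> T -> R, (forall n, E (f n)) ->
  (forall n x, f n.+1 x <= f n x) -> (forall x, f ^~ x @ \oo --> (0 : R)) ->
  L \o f @ \oo --> (0 : R).

Let Ecst c : E (cst c).
Proof.
rewrite (_ : cst c = (fun x : T => c * cst 1 x)); first exact: EZ.
by apply/funext => x; rewrite /cst mulr1.
Qed.

Let Lcst c : L (cst c) = c.
Proof.
rewrite (_ : cst c = (fun x : T => c * cst 1 x)); first by rewrite LZ// L1 mulr1.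
by apply/funext => x; rewrite /cst mulr1.
Qed.

Let EB f g : E f -> E g -> E (fun x => f x - g x).
Proof.
move=> Ef Eg; rewrite (_ : (fun _ => _) = (fun x => f x + (-1) * g x)).
  exact/ED/EZ.
by apply/funext => x; rewrite mulN1r.
Qed.

Let LB f g : E f -> E g -> L (fun x => f x - g x) = L f - L g.
Proof.
move=> Ef Eg; rewrite (_ : (fun _ => _) = (fun x => f x + (-1) * g x)).
  by rewrite LD ?LZ//; [rewrite mulN1r|exact: EZ].
by apply/funext => x; rewrite mulN1r.
Qed.

Let Emax f g : E f -> E g -> E (fun x => Num.max (f x) (g x)).
Proof.
move=> Ef Eg.
rewrite (_ : (fun _ => _) = (fun x => (f x + g x) - Num.min (f x) (g x))).
  by apply: EB; [exact: ED|exact: Emin].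
by apply/funext => x; rewrite -[f x + g x]addr_max_min addrK.
Qed.

Let le_L f g : E f -> E g -> (forall x, f x <= g x) -> L f <= L g.
Proof.
move=> Ef Eg fg; rewrite -subr_ge0 -LB//; apply: Lge0; first exact: EB.
by move=> x; rewrite subr_ge0.
Qed.

Let eq_L f g : (forall x, f x = g x) -> L f = L g.
Proof. by move=> /funext ->. Qed.

Let Esum (f : nat -> T -> R) n : (forall i, E (f i)) ->
  E (fun x => \sum_(i < n) f i x).
Proof.
move=> Ef; elim: n => [|n ih].
  by rewrite (_ : (fun _ => _) = cst 0)//; apply/funext => x; rewrite big_ord0.
rewrite (_ : (fun _ => _) = (fun x => \sum_(i < n) f i x + f n x)); first exact: ED.
by apply/funext => x; rewrite big_ord_recr.
Qed.

Let Lsum (f : nat -> T -> R) n : (forall i, E (f i)) ->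
  L (fun x => \sum_(i < n) f i x) = \sum_(i < n) L (f i).
Proof.
move=> Ef; elim: n => [|n ih].
  rewrite big_ord0; transitivity (L (cst 0)); last exact: Lcst.
  by apply: eq_L => x; rewrite big_ord0.
rewrite big_ord_recr/= -ih -LD//; last exact: Esum.
by apply: eq_L => x; rewrite big_ord_recr.
Qed.

(** Increasing sequences in [E] play the role of open covers: [outer A] is the least bound on [L]
    along a sequence that increases to 1 on [A]. Nothing but the range [0, 1] is asked off [A]. *)
Let approximates (A : set T) (g : nat -> T -> R) :=
  [/\ forall n, E (g n), forall n x, 0 <= g n x <= 1,
      forall m n x, (m <= n)%N -> g m x <= g n x
    & forall x, A x -> g ^~ x @ \oo --> (1 : R)].

Let bounds (A : set T) := [set c | exists2 g, approximates A g &
  forall n, L (g n) <= c].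

Let outer (A : set T) : R := inf (bounds A).

Let bounds1 A : bounds A 1.
Proof.
exists (fun=> cst 1); last by move=> n; rewrite L1.
split => //; first by move=> n x; rewrite /cst ler01 lexx.
by move=> x _; exact: cvg_cst.
Qed.

Let lbound_bounds A : lbound (bounds A) 0.
Proof.
move=> c [g [Eg g01 _ _] Lgc]; apply: le_trans (Lgc 0%N).
by apply: Lge0 => // x; have /andP[] := g01 0%N x.
Qed.

Let outer_le A c : bounds A c -> outer A <= c.
Proof. by move=> Ac; apply: ge_inf => //; exists 0; exact: lbound_bounds. Qed.

Let outer_ge A c : lbound (bounds A) c -> c <= outer A.
Proof. by move=> Ac; apply: lb_le_inf => //; exists 1; exact: bounds1. Qed.

Let outer_ge0 A : 0 <= outer A.
Proof. exact/outer_ge/lbound_bounds. Qed.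

Let outer_adherent A (e : R) : 0 < e -> exists2 c, bounds A c & c < outer A + e.
Proof.
move=> e0; apply: inf_adherent => //.
by split; [exists 1; exact: bounds1|exists 0; exact: lbound_bounds].
Qed.

Let le_outer A B : A `<=` B -> outer A <= outer B.
Proof.
move=> AB; apply: outer_ge => c [g [Eg g01 gnd gB] Lg]; apply: outer_le.
by exists g => //; split => // x /AB/gB.
Qed.

Let outer0 : outer set0 = 0.
Proof.
apply/eqP; rewrite eq_le outer_ge0 andbT; apply: outer_le.
exists (fun=> cst 0); last by move=> n; rewrite Lcst.
by split => // n x; rewrite /cst lexx ler01.
Qed.

Let mu (A : set T) : \bar R := (outer A)%:E.

Let mu_sigma_subadditive (A : set T) F : subset_sigma_subadditive mu A F.
Proof.
rewrite /subset_sigma_subadditive => AF.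
apply/lee_addgt0Pr => e e0.
apply: le_trans (epsilon_trick _ _ (ltW e0)); last first.
  by move=> n; rewrite lee_fin.
have ei0 i : 0 < e / (2 ^ i.+1)%:R by rewrite divr_gt0// ltr0n expn_gt0.
have /choice[g gP] : forall i, exists g, approximates (F i) g /\
    forall n, L (g n) <= outer (F i) + e / (2 ^ i.+1)%:R.
  move=> i; have [c [g ga Lg] /ltW cF] := outer_adherent (F i) (ei0 i).
  by exists g; split => // n; exact: le_trans (Lg n) cF.
have Eg i n : E (g i n) by have [[]] := gP i.
have g0 i n x : 0 <= g i n x by have [[_ /(_ n x)/andP[]]] := gP i.
pose S := (\sum_(i <oo) (mu (F i) + (e / (2 ^ i.+1)%:R)%:E))%E.
have partial n : ((\sum_(i < n) (outer (F i) + e / (2 ^ i.+1)%:R))%:E <= S)%E.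
  rewrite -sumEFin; under eq_bigr do rewrite EFinD.
  have := @nneseries_lim_ge R (fun i => (mu (F i) + (e / (2 ^ i.+1)%:R)%:E))%E
    xpredT 0 n.
  by rewrite big_mkord; apply => i _; rewrite adde_ge0// lee_fin// ltW.
rewrite -/S; have [->|Sfin] := eqVneq S +oo%E; first by rewrite leey.
have S_fin : S \is a fin_num.
  by rewrite ge0_fin_numE ?ltey//; apply: le_trans (partial 0%N); rewrite big_ord0.
rewrite -(fineK S_fin) lee_fin; apply: outer_le.
(* A diagonal cover of the union: stage [n] uses the first [n] sets only, each through stage [n] of
   its own cover. A point of [F i] is reached because the term of index [i] is present for all
   [n > i]. *)
pose h n x := Num.min 1 (\sum_(i < n) g i n x).
have Eh n : E (h n) by apply: Emin => //; apply: (Esum (f := g ^~ n)).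
exists h; last first.
  move=> n; apply: (@le_trans _ _ (\sum_(i < n) L (g i n))).
    rewrite -(Lsum (f := g ^~ n))//; apply: le_L => //; first exact: (Esum (f := g ^~ n)).
    by move=> x; rewrite /h ge_min lexx orbT.
  rewrite -lee_fin fineK//; apply: le_trans (partial n); rewrite lee_fin.
  by apply: ler_sum => i _; have [_] := gP i.
split => //.
- move=> n x; rewrite /h ge_min lexx/= andbT le_min ler01/=.
  by apply: sumr_ge0.
- move=> m n x mn; rewrite /h le_min ge_min lexx/= ge_min.
  apply/orP; right.
  rewrite (big_ord_widen n (fun i => g i m x) mn) [leRHS](bigID (fun i : 'I_n => (i < m)%N))/=.
  rewrite -[leLHS]addr0 lerD ?sumr_ge0// ler_sum// => i _.
  by have [[_ _ gnd _] _] := gP i; exact: gnd.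
- move=> x /AF[i _ Fix].
  have [[_ g01 _ /(_ _ Fix) gx1] _] := gP i.
  apply: (@squeeze_cvgr _ _ _ _ (g i ^~ x) (cst 1)) => //; last exact: cvg_cst.
  near=> n; rewrite /h ge_min lexx/= andbT le_min.
  have /andP[_ ->] := g01 n x.
  have ni : (i < n)%N by near: n; exact: nbhs_infty_gt.
  by rewrite /= (bigD1 (Ordinal ni))//= lerDl sumr_ge0.
Unshelve. all: by end_near. Qed.


Let om : {outer_measure set T -> \bar R} := HB.pack mu
  (isSubsetOuterMeasure.Build R T mu (congr1 EFin outer0)
    (fun A => outer_ge0 A) mu_sigma_subadditive).

(** The excess [max (h - g n) 0] over a cover [g] of [A] decreases to 0 at every point, so that [L]
    of it tends to 0 by Daniell continuity. This is what keeps the outer measure from being too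
    small. *)
Let L_le_outer h A : E h -> (forall x, h x <= 1) -> (forall x, ~ A x -> h x <= 0) ->
  L h <= outer A.
Proof.
move=> Eh h1 hA; apply: outer_ge => c [g [Eg g01 gnd gA] Lg].
pose k n x := Num.max (h x - g n x) 0.
have Ek n : E (k n) by exact: (Emax (EB Eh (Eg n)) (Ecst 0)).
have Lk : L \o k @ \oo --> (0 : R).
  apply: Lcvg0 => // [n x|x].
    by rewrite /k ge_max !le_max lexx orbT andbT lerD2l lerN2 gnd.
  have [Ax|nAx] := pselect (A x); last first.
    rewrite (_ : k ^~ x = cst 0); first exact: cvg_cst.
    apply/funext => n; rewrite /k/=; apply/max_idPr.
    by rewrite subr_le0 (le_trans (hA _ nAx))//; have /andP[] := g01 n x.
  apply: (@squeeze_cvgr _ _ _ _ (cst 0) (fun n => 1 - g n x)).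
  - near=> n; rewrite /= /k le_max lexx orbT/= ge_max lerD2r h1/= subr_ge0.
    by have /andP[] := g01 n x.
  - exact: cvg_cst.
  - by rewrite -[X in _ --> X](subrr (1 : R)); apply: cvgB; [exact: cvg_cst|exact: gA].
rewrite -subr_le0; apply: (cvgr_to_ge Lk); near=> n => /=.
rewrite lerBlDr -lerBlDl.
have -> : L h - L (k n) = L (fun x => h x - k n x) by rewrite LB.
apply: le_trans (Lg n); apply: le_L => //; first exact: EB.
by move=> x; rewrite lerBlDr -lerBlDl /k le_max lexx.
Unshelve. all: by end_near. Qed.

Let outer_le_L h A : E h -> (forall x, 0 <= h x) -> (forall x, A x -> 1 <= h x) ->
  outer A <= L h.
Proof.
move=> Eh h0 hA; apply: outer_le.
exists (fun=> (fun x => Num.min (h x) 1)); last first.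
  by move=> n; apply: le_L => //; [exact: (Emin Eh E1)|move=> x; rewrite ge_min lexx].
split=> //.
- by move=> n; exact: (Emin Eh E1).
- by move=> n x; rewrite le_min h0 ler01 ge_min lexx orbT.
- by move=> x /hA h1; rewrite min_r//; exact: cvg_cst.
Qed.

(* A cover [g] of [X] splits into [min (g m) (m f)], which covers
   [X `&` [set x | 0 < f x]], and [max (g m - n f) 0] for a large fixed [n],
   which covers the rest. *)
Let caratheodory_gt0 f : E f -> om.-caratheodory [set x | 0 < f x].
Proof.
move=> Ef; pose f' x := Num.max (f x) 0.
have Ef' : E f' by exact: (Emax Ef (Ecst 0)).
have f'0 x : 0 <= f' x by rewrite /f' le_max lexx orbT.
have Enf' n : E (fun x => n%:R * f' x) by exact: EZ.
have nf'0 n x : 0 <= n%:R * f' x by rewrite mulr_ge0.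
apply: le_caratheodory_measurable => X; rewrite -EFinD lee_fin.
set B := [set x | _].
apply: outer_ge => c [g [Eg g01 gnd gX] Lg].
have g0 n x : 0 <= g n x by have /andP[] := g01 n x.
have g1 n x : g n x <= 1 by have /andP[] := g01 n x.
pose u n x := Num.min (g n x) (n%:R * f' x).
have Eu n : E (u n) by exact: Emin.
pose U := sup (range (L \o u)).
have Uub n : L (u n) <= U.
  apply: ub_le_sup; last by exists n.
  exists c => _ [m _ <-]; apply: le_trans (Lg m); apply: le_L => // x.
  by rewrite /u ge_min lexx.
have XB : outer (X `&` B) <= U.
  apply: outer_le; exists u => //; split => //.
  - by move=> n x; rewrite /u le_min g0 nf'0 ge_min g1.
  - move=> m n x mn; rewrite /u le_min ge_min gnd//= ge_min.
    by rewrite ler_wpM2r ?orbT// ler_nat.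
  - move=> x [Xx Bx].
    have f'x : 0 < f' x by rewrite /f' lt_max Bx.
    apply: cvg_trans (gX _ Xx); apply: near_eq_cvg; near=> n.
    rewrite /u min_l// (le_trans (g1 n x))// -ler_pdivrMr// mul1r.
    by near: n; exact: nbhs_infty_ger.
apply/ler_addgt0Pr => e e0.
have [_ [n _ <-]/= nU] : exists2 a, range (L \o u) a & U - e < a.
  apply: sup_adherent => //; split; first by exists (L (u 0%N)), 0%N.
  exists c => _ [m _ <-]; apply: le_trans (Lg m); apply: le_L => // x.
  by rewrite /u ge_min lexx.
suff XB' : outer (X `&` ~` B) <= c - U + e by lra.
apply: outer_le.
pose w m x := Num.min (g (m + n)%N x) (n%:R * f' x).
have Ew m : E (w m) by exact: Emin.
exists (fun m x => g (m + n)%N x - w m x).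
  split.
  - by move=> m; exact: EB.
  - move=> m x; rewrite subr_ge0 /w ge_min lexx/= lerBlDr.
    by rewrite (le_trans (g1 _ x))// lerDl le_min g0 nf'0.
  - move=> m p x mp.
    have : g (m + n)%N x <= g (p + n)%N x by rewrite gnd// leq_add2r.
    rewrite /w; move: (g (m + n)%N x) (g (p + n)%N x) (n%:R * f' x) => a b d ab.
    by rewrite /Num.min; case: ifPn => ?; case: ifPn => ?; lra.
  - move=> x [Xx /negP]; rewrite -leNgt => fx.
    rewrite (_ : (fun m => _) = (fun m => g (m + n)%N x)).
      by have := gX x Xx; rewrite -(cvg_shiftn n).
    apply/funext => m; rewrite /w /f' max_r// mulr0 min_r// subr0//.
move=> m; rewrite LB//.
have : L (u n) <= L (w m).
  apply: le_L => // x; rewrite /u /w le_min ge_min gnd//= ?leq_addl//.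
  by rewrite ge_min lexx orbT.
by have := Lg (m + n)%N; move: (L (w m)) (L _) => p q; lra.
Unshelve. all: by end_near. Qed.

Let Om : measurableType _ := caratheodory_type om.

Let m : {measure set (caratheodory_type om) -> \bar R} := om.

Let om_setT : m setT = 1%E.
Proof.
congr EFin; apply/eqP; rewrite eq_le; apply/andP; split.
  exact/outer_le/bounds1.
rewrite -[leLHS]L1; apply: L_le_outer => //.
by move=> x /(_ I).
Qed.

Let P : probability Om R := HB.pack (Measure.sort m)
  (Measure_isProbability.Build _ _ _ (Measure.sort m) om_setT).

Let measurable_gt f c : E f -> measurable ([set x | c < f x] : set Om).
Proof.
move=> Ef; rewrite (_ : [set x | _] = [set x | 0 < f x - c]).
  exact/caratheodory_gt0/(EB Ef (Ecst c)).
by apply/seteqP; split => x /=; rewrite subr_gt0.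
Qed.

Let measurable_E f : E f -> measurable_fun setT (f : Om -> R).
Proof.
move=> Ef; apply: (measurability _ (measurable_realfun.RGenOInfty.measurableE R)).
move=> _ [_ [c ->] <-]; rewrite setTI.
rewrite (_ : _ @^-1` _ = [set x | c < f x]); first exact: measurable_gt.
by apply/seteqP; split => x /=; rewrite in_itv/= andbT.
Qed.

Let Eb f := [/\ E f, forall x, 0 <= f x & exists c, forall x, f x <= c].

(** The layer of [f] between the heights [i / N] and [(i + 1) / N], rescaled to have values in
    [0, 1]. *)
Let slice (N i : nat) (f : T -> R) x : R :=
  N%:R * Num.min (Num.max (f x - i%:R / N%:R) 0) N%:R^-1.

Let sliceE N f x : (0 < N)%N -> 0 <= f x <= 1 ->
  f x = \sum_(i < N) N%:R^-1 * slice N i f x.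
Proof.
move=> N0 /andP[f0 f1]; pose d : R := N%:R^-1.
have Nd : N%:R * d = 1 by rewrite mulfV// pnatr_eq0 -lt0n.
have d0 : 0 < d by rewrite invr_gt0 ltr0n.
have sliceM i : d * slice N i f x = Num.min (Num.max (f x - i%:R * d) 0) d.
  by rewrite /slice mulrA [d * _]mulrC Nd mul1r.
have partial k : \sum_(i < k) d * slice N i f x = Num.min (f x) (k%:R * d).
  elim: k => [|k ih]; first by rewrite big_ord0 mul0r min_r.
  rewrite big_ord_recr/= ih sliceM -natr1 mulrDl mul1r.
  move: (k%:R * d) => a; rewrite /Num.min /Num.max.
  by repeat case: ifPn; rewrite -?leNgt; move=> *; lra.
by rewrite partial Nd min_l.
Qed.

Let Eb_slice N i f : E f -> (0 < N)%N -> Eb (slice N i f).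
Proof.
move=> Ef N0; have N0' : 0 < N%:R :> R by rewrite ltr0n.
split.
- exact: (EZ _ (Emin (Emax (EB Ef (Ecst _)) (Ecst 0)) (Ecst _))).
- move=> x; rewrite /slice mulr_ge0// le_min invr_ge0 le_max lexx orbT/=.
  by rewrite ler0n.
- exists 1 => x; rewrite /slice -ler_pdivlMl// mulr1.
  by rewrite ge_min lexx orbT.
Qed.

(** Each layer lies between the indicators of two consecutive superlevel sets. [K] is abstract
    because the lemma serves twice, for [L] and for the integral: both are caught between the same
    two sums. *)
Let layer_cake (K : (T -> R) -> R) (N : nat) (f : T -> R) :
  (forall f g, Eb f -> Eb g -> K (fun x => f x + g x) = K f + K g) ->
  (forall (c : R) f, 0 <= c -> Eb f -> K (fun x => c * f x) = c * K f) ->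
  (forall f c, Eb f -> (forall x, f x <= 1) -> E c ->
    (forall x, c x <= 0 -> f x <= 0) -> K f <= outer [set x | 0 < c x]) ->
  (forall f c, Eb f -> E c ->
    (forall x, 0 < c x -> 1 <= f x) -> outer [set x | 0 < c x] <= K f) ->
  (0 < N)%N -> E f -> (forall x, 0 <= f x <= 1) ->
  N%:R^-1 * \sum_(i < N) outer [set x | 0 < f x - i.+1%:R / N%:R] <= K f <=
  N%:R^-1 * \sum_(i < N) outer [set x | 0 < f x - i%:R / N%:R].
Proof.
move=> KD KZ Kle Kge N0 Ef f01.
have N0' : 0 < N%:R :> R by rewrite ltr0n.
have K0 : K (fun=> 0) = 0.
  have E0 : Eb (fun=> 0).
    by split => //; [exact: (Ecst 0)|exists 0].
  have -> : (fun=> 0 : R) = (fun x : T => 0 * (fun=> 0 : R) x).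
    by apply/funext => x; rewrite mul0r.
  by rewrite KZ// mul0r.
have EbD g h : Eb g -> Eb h -> Eb (fun x => g x + h x).
  move=> [Eg g0 [c gc]] [Eh h0 [b hb]]; split; first exact: ED.
    by move=> x; rewrite addr_ge0.
  by exists (c + b) => x; rewrite lerD.
have EbZ c g : 0 <= c -> Eb g -> Eb (fun x => c * g x).
  move=> c0 [Eg g0 [b gb]]; split; first exact: EZ.
    by move=> x; rewrite mulr_ge0.
  by exists (c * b) => x; rewrite ler_wpM2l.
have d0 : 0 <= N%:R^-1 :> R by rewrite invr_ge0 ltW.
have sumK k : Eb (fun x => \sum_(i < k) N%:R^-1 * slice N i f x) /\
    K (fun x => \sum_(i < k) N%:R^-1 * slice N i f x) =
    N%:R^-1 * \sum_(i < k) K (slice N i f).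
  elim: k => [|k [ih1 ih2]].
    have -> : (fun x => \sum_(i < 0) N%:R^-1 * slice N i f x) = (fun=> 0).
      by apply/funext => x; rewrite big_ord0.
    rewrite K0 big_ord0 mulr0; split => //.
    by split => //; [exact: (Ecst 0)|exists 0].
  have -> : (fun x => \sum_(i < k.+1) N%:R^-1 * slice N i f x) =
      (fun x => \sum_(i < k) N%:R^-1 * slice N i f x + N%:R^-1 * slice N k f x).
    by apply/funext => x; rewrite big_ord_recr.
  have Ebk : Eb (slice N k f) by exact: Eb_slice.
  split; first by apply: EbD => //; exact: EbZ.
  rewrite (KD _ _ ih1)//; last exact: EbZ.
  by rewrite KZ// ih2 big_ord_recr/= mulrDr.
have Ks : K f = N%:R^-1 * \sum_(i < N) K (slice N i f).
  by rewrite -(sumK N).2; congr K; apply/funext => x; exact: sliceE.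
rewrite Ks !ler_pM2l ?invr_gt0//; apply/andP; split.
  apply: ler_sum => i _; apply: Kge; [exact: Eb_slice|exact: (EB Ef (Ecst _))|].
  move=> x; rewrite subr_gt0 /slice => ifx.
  rewrite -ler_pdivrMl// mulr1 le_min lexx andbT le_max; apply/orP; left.
  rewrite lerBrDr; apply: le_trans (ltW ifx).
  by rewrite -natr1 mulrDl mul1r addrC.
apply: ler_sum => i _; apply: Kle; [exact: Eb_slice| |exact: (EB Ef (Ecst _))|].
  by move=> x; rewrite /slice -ler_pdivlMl// mulr1 ge_min lexx orbT.
move=> x h; rewrite /slice max_r// min_l ?mulr0//.
Qed.

Let I (f : T -> R) := (\int[P]_x f x)%R.

Let Eb_integrable f : Eb f -> P.-integrable setT (EFin \o f).
Proof.
move=> [Ef f0 [c fc]].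
apply: (@le_integrable _ _ _ P _ measurableT _ (EFin \o cst c)).
- exact/measurable_EFinP/measurable_E.
- move=> x _ /=; rewrite lee_fin !ger0_norm//.
  exact: le_trans (f0 x) (fc x).
- exact: finite_measure_integrable_cst.
Qed.

Let I_indic c : E c -> I (\1_[set x | 0 < c x]) = outer [set x | 0 < c x].
Proof.
by move=> Ec; rewrite /I /Rintegral integral_indic// ?setIT//; exact: measurable_gt.
Qed.

Let outer_setT : outer setT <= 1.
Proof. exact/outer_le/bounds1. Qed.

Let L_int_bounded f : E f -> (forall x, 0 <= f x <= 1) -> L f = I f.
Proof.
move=> Ef f01; apply/eqP; rewrite -subr_eq0 -normr_le0.
have key N : (0 < N)%N -> `|L f - I f| <= N%:R^-1.
  move=> N0; pose a i := outer [set x | 0 < f x - i%:R / N%:R].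
  have N0' : 0 < N%:R^-1 :> R by rewrite invr_gt0 ltr0n.
  have [Ll Lu] : N%:R^-1 * \sum_(i < N) a i.+1 <= L f /\
      L f <= N%:R^-1 * \sum_(i < N) a i.
    apply/andP; apply: layer_cake => //.
    - by move=> ? ? [? _ _] [? _ _]; exact: LD.
    - by move=> ? ? _ [? _ _]; exact: LZ.
    - move=> g c [Eg _ _] g1 Ec cg; apply: L_le_outer => // x /negP.
      by rewrite -leNgt; exact: cg.
    - by move=> g c [Eg g0 _] Ec cg; exact: outer_le_L.
  have [Il Iu] : N%:R^-1 * \sum_(i < N) a i.+1 <= I f /\
      I f <= N%:R^-1 * \sum_(i < N) a i.
    apply/andP; apply: layer_cake => //.
    - by move=> ? ? ? ?; rewrite /I RintegralD//; exact: Eb_integrable.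
    - by move=> ? ? _ ?; rewrite /I RintegralZl//; exact: Eb_integrable.
    - move=> g c Eg g1 Ec cg; rewrite -I_indic//; apply: le_Rintegral => //.
      + exact: Eb_integrable.
      + by apply: integrable_indic; exact: measurable_gt.
      + move=> x _; rewrite indicE; case: (boolP (x \in _)) => [_|]; first exact: g1.
        by rewrite notin_setE/= => /negP; rewrite -leNgt; exact: cg.
    - move=> g c Eg Ec cg; rewrite -I_indic//; apply: le_Rintegral => //.
      + by apply: integrable_indic; exact: measurable_gt.
      + exact: Eb_integrable.
      + move=> x _; rewrite indicE; case: (boolP (x \in _)) => [|_].
          by rewrite inE/=; exact: cg.
        by have [_ + _] := Eg; exact.
  (* The two sums differ by the telescoping [a 0 - a N], so [L f] and [I f] are within [1 / N] of
     each other. *)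
  have : \sum_(i < N) a i - \sum_(i < N) a i.+1 <= 1.
    rewrite -sumrB -(big_mkord xpredT (fun i => a i - a i.+1)).
    under eq_bigr do rewrite -opprB.
    rewrite sumrN telescope_sumr// opprB.
    have : a 0%N <= 1 by apply: le_trans outer_setT; exact: le_outer.
    have := outer_ge0 [set x | 0 < f x - N%:R / N%:R]; rewrite -/(a N); lra.
  rewrite -(ler_pM2l N0') mulrBr mulr1 => /(le_trans _); apply.
  by rewrite ler_norml; apply/andP; split; lra.
apply/ler_addgt0Pr => e e0; rewrite add0r.
have [N _ /(_ N (leqnn N))/= /ltW Ne] := near_infty_natSinv_lt (PosNum e0).
exact/(le_trans _ Ne)/key.
Qed.

(** Truncation at height [n + 1], positive so that one may divide by it, reduces to values in
    [0, 1]. The integral passes to the limit by monotone convergence, and [L] by Daniell continuity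
    applied to the remainders, which decrease to 0. *)
Let L_int_ge0 f : E f -> (forall x, 0 <= f x) ->
  (\int[P]_x (f x)%:E = (L f)%:E)%E.
Proof.
move=> Ef f0; pose g n x := Num.min (f x) n.+1%:R.
have Eg n : E (g n) by exact: (Emin Ef (Ecst _)).
have Ebg n : Eb (g n).
  split => //; first by move=> x; rewrite /g le_min f0 ler0n.
  by exists n.+1%:R => x; rewrite /g ge_min lexx orbT.
have Lg n : (\int[P]_x (g n x)%:E = (L (g n))%:E)%E.
  pose h x := n.+1%:R^-1 * g n x.
  have gh : g n = (fun x => n.+1%:R * h x).
    by apply/funext => x; rewrite /h mulrA mulfV ?mul1r// pnatr_eq0.
  have Eh : E h by exact: EZ.
  have h01 x : 0 <= h x <= 1.
    rewrite /h mulr_ge0//=; last by have [_] := Ebg n.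
    by rewrite ler_pdivrMl ?ltr0Sn// mulr1 /g ge_min lexx orbT.
  have Ebh : Eb h.
    by split => //; [|exists 1] => x; have /andP[] := h01 x.
  have -> : L (g n) = I (g n).
    rewrite gh LZ// /I RintegralZl//; last exact: Eb_integrable.
    by congr (_ * _); exact: L_int_bounded.
  rewrite /I /Rintegral fineK//; apply: integrable_fin_num => //.
  exact: Eb_integrable.
have Lcvg : (L (g n))%:E @[n --> \oo] --> (L f)%:E.
  apply/fine_cvgP; split; first exact: nearW.
  rewrite /comp/=.
  rewrite -[X in X @ _](_ : (fun n => L f - L (fun x => f x - g n x)) = _); last first.
    by apply/funext => n; rewrite LB//; lra.
  rewrite -[X in _ --> X]subr0; apply: cvgB; first exact: cvg_cst.
  apply: (Lcvg0 (f := fun n x => f x - g n x)).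
  - by move=> n; exact: EB.
  - move=> n x; rewrite lerD2l lerN2 /g le_min !ge_min lexx/=.
    by rewrite ler_nat leqnSn orbT.
  - move=> x; apply: cvg_near_cst; near=> n; rewrite /g min_l ?subrr//.
    apply: (@le_trans _ _ n%:R); last by rewrite ler_nat.
    by near: n; exact: nbhs_infty_ger.
have gl x : limn (fun n => (g n x)%:E) = (f x)%:E.
  apply/cvg_lim => //; apply: cvg_near_cst; near=> n; rewrite /g min_l//.
  apply: (@le_trans _ _ n%:R); last by rewrite ler_nat.
  by near: n; exact: nbhs_infty_ger.
have mg n : measurable_fun setT (fun x : Om => (g n x)%:E).
  exact/measurable_EFinP/measurable_E.
have g0 n x : setT x -> (0 <= (g n x)%:E)%E.
  by move=> _; rewrite lee_fin; have [_] := Ebg n.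
have gnd x : setT x -> {homo (fun n => (g n x)%:E) : n k / (n <= k)%N >-> (n <= k)%E}.
  move=> _ n k nk; rewrite lee_fin /g le_min !ge_min lexx/=.
  by rewrite ler_nat ltnS nk orbT.
transitivity (\int[P]_x (limn (fun n => (g n x)%:E)))%E.
  by apply: eq_integral => x _; rewrite gl.
rewrite (@monotone_convergence _ _ _ P setT measurableT _ mg g0 gnd).
by under eq_fun do rewrite Lg; exact/cvg_lim.
Unshelve. all: by end_near. Qed.

Let ge0_integrable f : E f -> (forall x, 0 <= f x) ->
  P.-integrable setT (EFin \o f).
Proof.
move=> Ef f0; apply/integrableP; split.
  exact/measurable_EFinP/measurable_E.
under eq_integral do rewrite /= ger0_norm//.
by rewrite L_int_ge0// ltry.
Qed.

Let L_int f : E f ->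
  P.-integrable setT (EFin \o f) /\ (\int[P]_x (f x)%:E = (L f)%:E)%E.
Proof.
move=> Ef; pose p x := Num.max (f x) 0; pose q x := Num.max (f x) 0 - f x.
have Ep : E p by exact: (Emax Ef (Ecst 0)).
have Eq : E q by exact: EB.
have p0 x : 0 <= p x by rewrite /p le_max lexx orbT.
have q0 x : 0 <= q x by rewrite subr_ge0 le_max lexx.
have fpq : f = (fun x => p x - q x) by apply/funext => x; rewrite /q /p; lra.
have ip : P.-integrable setT (EFin \o p) by exact: ge0_integrable.
have iq : P.-integrable setT (EFin \o q) by exact: ge0_integrable.
rewrite fpq LB//; split; first exact: (integrableB measurableT ip iq).
under eq_integral do rewrite EFinB.
by rewrite integralB_EFin// !L_int_ge0.
Qed.

(** [T] carries no sigma-algebra of its own. [Omega] is [T] with the Caratheodory sets of the outer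
    measure and [X] is the identity, so measurability can be stated only for the compositions
    [f \o X]. *)
Theorem daniell : exists (d : measure_display) (Omega : measurableType d)
  (mu : probability Omega R) (X : Omega -> T), forall f, E f ->
  [/\ measurable_fun setT (f \o X), mu.-integrable setT (EFin \o (f \o X)) &
    (\int[mu]_w (f (X w))%:E = (L f)%:E)%E].
Proof.
exists (caratheodory_display om), Om, P, id => f Ef.
by have [? ?] := L_int Ef; split => //; exact: measurable_E.
Qed.

End daniell.

(** * Disintegration of measures on a product with the line *)

Section probability_of_rational_cdf.
Context {R : realType}.
Variable h : rat -> R.
Hypothesis h_nd : forall p q, p <= q -> h p <= h q.
Hypothesis h01 : forall q, 0 <= h q <= 1.
Hypothesis h_lim : forall k, exists n,
  h (- n%:R) < k.+1%:R^-1 /\ 1 - k.+1%:R^-1 < h n%:R.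

(** The right-continuous regularisation of [h]; the strict inequality [y < ratr q] is what makes it
    right-continuous, with no such assumption on [h]. *)
Let F (y : R) : R := inf [set h q | q in [set q : rat | y < ratr q]].

Let F_le y q : y < ratr q -> F y <= h q.
Proof.
move=> yq; apply: ge_inf; last by exists q.
by exists 0 => _ [p _ <-]; have /andP[] := h01 p.
Qed.

Let rat_gt (y : R) : exists q : rat, y < ratr q.
Proof.
have y1 : y < y + 1 by rewrite ltrDl.
by have [q] := rat_in_itvoo y1; rewrite in_itv/= => /andP[yq _]; exists q.
Qed.

Let F_ge y c : (forall q, y < ratr q -> c <= h q) -> c <= F y.
Proof.
move=> ch; apply: lb_le_inf; last by move=> _ [q yq <-]; exact: ch.
by have [q yq] := rat_gt y; exists (h q), q.
Qed.

Let F_adherent y (e : R) : 0 < e -> exists2 q, y < ratr q & h q < F y + e.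
Proof.
move=> e0.
have [|_ [q yq <-] hq] := @inf_adherent _ [set h q | q in [set q : rat | y < ratr q]] _ e0.
  split; first by have [q yq] := rat_gt y; exists (h q), q.
  by exists 0 => _ [p _ <-]; have /andP[] := h01 p.
by exists q.
Qed.

Let F_nd : nondecreasing F.
Proof. by move=> y z yz; apply: F_ge => q zq; apply: F_le; exact: le_lt_trans zq. Qed.

Let F_rc : right_continuous F.
Proof.
move=> y; apply/cvgrPdist_le => e e0.
have [q yq hq] := F_adherent y e0.
near=> z; have yz : y < z by near: z; exact: nbhs_right_gt.
have zq : z < ratr q by near: z; exact: nbhs_right_lt.
rewrite distrC ger0_norm; last by rewrite subr_ge0 F_nd// ltW.
by rewrite lerBlDl ltW//; exact: le_lt_trans (F_le zq) hq.
Unshelve. all: by end_near. Qed.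

Let F0 y : 0 <= F y.
Proof. by apply: F_ge => q _; have /andP[] := h01 q. Qed.

Let F1 y : F y <= 1.
Proof. by have [q /F_le Fq] := rat_gt y; have /andP[_] := h01 q; exact: le_trans. Qed.

Let FNy : F @ -oo --> (0 : R).
Proof.
apply/cvgrPdist_le => e e0.
have [k _ /(_ k (leqnn k))/= ke] := near_infty_natSinv_lt (PosNum e0).
have [n [hn _]] := h_lim k.
near=> z; rewrite sub0r normrN ger0_norm//.
apply: le_trans (ltW (lt_trans hn ke)); apply: F_le.
rewrite rmorphN/= ratr_nat; apply: (@le_lt_trans _ _ (- (n%:R + 1))); last by lra.
by near: z; apply: nbhs_ninfty_le; exact: num_real.
Unshelve. all: by end_near. Qed.

Let Fy : F @ +oo --> (1 : R).
Proof.
apply/cvgrPdist_le => e e0.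
have [k _ /(_ k (leqnn k))/= ke] := near_infty_natSinv_lt (PosNum e0).
have [n [_ hn]] := h_lim k.
near=> z; rewrite ger0_norm ?subr_ge0//.
have : h n%:R <= F z.
  apply: F_ge => q zq; apply: h_nd; rewrite -(ler_rat R) ratr_nat ltW//.
  by apply: le_lt_trans zq; near: z; apply: nbhs_pinfty_ge; exact: num_real.
by move: hn ke; move: (F z) (h _) (k.+1%:R^-1) => a b c; lra.
Unshelve. all: by end_near. Qed.

Let idTR : measurableTypeR R -> R := idfun.

#[local] HB.instance Definition _ :=
  @isMeasurableFun.Build _ _ _ _ idTR (@measurable_id _ _ setT).

#[local] HB.instance Definition _ := isCumulative.Build R _ R F F_nd F_rc.

#[local] HB.instance Definition _ := isCumulativeBounded.Build R 0 1 F FNy Fy.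

Lemma probability_of_rational_cdf : exists P : probability R R, forall y : R,
  P `]-oo, y]%classic = (inf [set h q | q in [set q : rat | y < ratr q]])%:E.
Proof.
exists (distribution (lebesgue_stieltjes_measure F) idTR) => y.
exact: (@cdf_lebesgue_stieltjes_id R F y).
Qed.

End probability_of_rational_cdf.

Section disintegration.
Context d {S : measurableType d} {R : realType} (J : probability (S * R)%type R).

Section slab.
Variables (B : set R) (mB : measurable B).

Let slab (A : set S) := J (A `*` B).

Let slab0 : slab set0 = 0%E.
Proof. by rewrite /slab set0X measure0. Qed.

Let slab_ge0 A : (0 <= slab A)%E.
Proof. exact: measure_ge0. Qed.

Let slab_sigma_additive : semi_sigma_additive slab.
Proof.
move=> A mA tA mUA; rewrite /slab.
have -> : \bigcup_n A n `*` B = \bigcup_n (A n `*` B).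
  apply/seteqP; split => [[s y] /= [[n _ As] By]|[s y] [n _ /= [As By]]].
    by exists n.
  by split => //; exists n.
apply: measure_semi_sigma_additive.
- by move=> i; exact: measurableX.
- apply/trivIsetP => i j _ _ ij; rewrite -subset0 => -[s y] /= [[Ai _] [Aj _]].
  by have /trivIsetP/(_ i j I I ij) := tA; rewrite -subset0 => /(_ s); exact.
- by apply: bigcupT_measurable => n; exact: measurableX.
Qed.

Let slab_fin : fin_num_fun slab.
Proof.
by move=> A mA; apply: fin_num_measure; exact: measurableX.
Qed.

Let slab_m : {measure set S -> \bar R} := HB.pack slab
  (isMeasure.Build _ _ _ slab slab0 slab_ge0 slab_sigma_additive).

Definition slab_measure : {finite_measure set S -> \bar R} :=
  HB.pack (Measure.sort slab_m)
    (Measure_isFinite.Build _ _ _ (Measure.sort slab_m) slab_fin).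

Lemma slab_measureE A : slab_measure A = J (A `*` B).
Proof. by []. Qed.

End slab.

Let mu := slab_measure (@measurableT _ R).

(** A version of the conditional probability of [B] given the first coordinate, nonnegative
    everywhere and not merely almost everywhere. *)
Definition slab_density (B : set R) (f : S -> R) :=
  [/\ measurable_fun setT f, forall s, 0 <= f s &
      forall A, measurable A -> (J (A `*` B) = \int[mu]_(s in A) (f s)%:E)%E].


Let slab_density_ex B : measurable B -> exists f, slab_density B f.
Proof.
move=> mB.
have [|f [f0 ffin intf fE]] := @radon_nikodym_sigma_finite _ S R mu (slab_measure mB).
  move=> A A0 C mC CA; apply/eqP; rewrite eq_le measure_ge0 andbT.
  rewrite -(A0 C mC CA); apply: le_measure; rewrite ?inE; try exact: measurableX.
  by move=> [s y] /= [].
exists (fine \o f); split => //=.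
- by apply: measurableT_comp => //; exact: measurable_int intf.
- by move=> s; rewrite fine_ge0.
- by move=> A mA; rewrite -(slab_measureE mB) fE//; apply: eq_integral => s _; rewrite /= fineK.
Qed.

Let slab_density_integrable B f : measurable B -> slab_density B f ->
  mu.-integrable setT (EFin \o f).
Proof.
move=> mB [mf f0 fE]; apply/integrableP; split; first exact/measurable_EFinP.
under eq_integral do rewrite /= ger0_norm//.
rewrite -fE// ltey_eq; apply/orP; left; apply: fin_num_measure.
exact: measurableX.
Qed.

Let slab_densityD B C f g h : measurable B -> measurable C -> B `&` C = set0 ->
  slab_density B f -> slab_density C g -> slab_density (B `|` C) h ->
  {ae mu, forall s, f s + g s = h s}.
Proof.
move=> mB mC BC sf sg sh.
have mBC : measurable (B `|` C) by exact: measurableU.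
have If := slab_density_integrable mB sf.
have Ig := slab_density_integrable mC sg.
have Ih := slab_density_integrable mBC sh.
have [mf f0 fE] := sf; have [mg g0 gE] := sg; have [mh h0 hE] := sh.
have : ae_eq mu setT (fun s => (f s)%:E + (g s)%:E)%E (EFin \o h).
  apply: integral_ae_eq => //; first exact: integrableD.
    exact: measurable_int Ih.
  move=> A _ mA; rewrite -hE// ge0_integralD//; last 4 first.
  - by move=> s _; rewrite lee_fin.
  - by apply: measurable_funTS; exact/measurable_EFinP.
  - by move=> s _; rewrite lee_fin.
  - by apply: measurable_funTS; exact/measurable_EFinP.
  rewrite -fE// -gE// -measureU.
  - by congr (J _); apply/seteqP; split => -[s y] /=; tauto.
  - exact: measurableX.
  - exact: measurableX.
  - rewrite -subset0 => -[s y] /= [[_ By] [_ Cy]].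
    by have : (B `&` C) y by []; rewrite BC.
by apply: filterS => s /(_ I)/= [].
Qed.

Let slab_densityT h : slab_density setT h -> {ae mu, forall s, h s = 1}.
Proof.
move=> sh; have Ih := slab_density_integrable measurableT sh.
have [mh h0 hE] := sh.
have : ae_eq mu setT (EFin \o h) (cst 1%E).
  apply: integral_ae_eq => // A _ mA.
  by rewrite -hE// integral_cst// mul1e.
by apply: filterS => s /(_ I)/= [].
Qed.

Let slab_density_le B C f g : measurable B -> measurable C -> B `<=` C ->
  slab_density B f -> slab_density C g -> {ae mu, forall s, f s <= g s}.
Proof.
move=> mB mC BC sf sg; have mCB : measurable (C `\` B) by exact: measurableD.
have [h sh] := slab_density_ex mCB.
have BCB : B `&` (C `\` B) = set0 by rewrite setIDA setIC -setIDA setDv setI0.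
have sg' : slab_density (B `|` (C `\` B)) g by rewrite setDUK.
have := slab_densityD mB mCB BCB sf sh sg'.
by apply: filterS => s <-; have [_ h0 _] := sh; rewrite lerDl.
Qed.

(** A Markov bound: on the set [A] where every [f n] is at least [1 / (k + 1)], the mass
    [mu A / (k + 1)] is at most [J (setT]*[B n)], which tends to 0. *)
Let slab_density_cvg0 (B : nat -> set R) f : (forall n, measurable (B n)) ->
  (forall n, slab_density (B n) (f n)) -> nonincreasing_seq B ->
  \bigcap_n B n = set0 ->
  {ae mu, forall s k, exists n, f n s < k.+1%:R^-1}.
Proof.
move=> mB sf Bnd B0; apply: ae_foralln => k.
pose A := \bigcap_n [set s | k.+1%:R^-1 <= f n s].
have mA : measurable A.
  apply: bigcapT_measurable => n; rewrite -[X in measurable X]setTI.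
  by have [mf _ _] := sf n; exact: measurable_fun_le.
exists A; split => //; last first.
  move=> s /= h n _ /=; rewrite leNgt; apply/negP => fns; apply: h.
  by exists n.
have JB : J (setT `*` B n) @[n --> \oo] --> 0%E.
  rewrite -(measure0 J).
  have -> : set0 = \bigcap_n (setT `*` B n) :> set (S * R).
    apply/esym; rewrite -subset0 => -[s y] h.
    have : (\bigcap_n B n) y by move=> n _; have [] := h n I.
    by rewrite B0.
  apply: nonincreasing_cvg_mu.
  - by rewrite ltey_eq fin_num_measure//; exact: measurableX.
  - by move=> n; exact: measurableX.
  - by apply: bigcapT_measurable => n; exact: measurableX.
  - move=> m n mn; apply/subsetPset => -[s y] /= [_ By]; split => //.
    by have /subsetPset := Bnd _ _ mn; apply.
have k0 : 0 < k.+1%:R^-1 :> R by rewrite invr_gt0.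
have Ale n : (k.+1%:R^-1%:E * mu A <= J (setT `*` B n))%E.
  have [mf f0 fE] := sf n.
  rewrite -integral_cst//; apply: (@le_trans _ _ (J (A `*` B n))).
    rewrite fE//; apply: ge0_le_integral => //.
    - by move=> s _; rewrite /cst lee_fin ltW.
    - by apply: measurable_funTS; exact/measurable_EFinP.
    - by move=> s As; rewrite /cst lee_fin; exact: (As n I).
  by apply: le_measure; rewrite ?inE; try exact: measurableX; move=> [s y] [].
have : (k.+1%:R^-1%:E * mu A <= 0)%E by apply: (cvge_to_ge JB); exact: nearW.
rewrite pmule_rle0 ?lte_fin// => muA.
by apply/eqP; rewrite eq_le muA measure_ge0.
Qed.

(** For rational thresholds, monotonicity and the limits at both ends are countably many almost sure
    statements. They hold together off one null set, on which the densities can be redefined. *)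
Let density_rat : exists g : rat -> S -> R, [/\ forall q, measurable_fun setT (g q),
   forall q A, measurable A -> J (A `*` `]-oo, ratr q]%classic) = (\int[mu]_(s in A) (g q s)%:E)%E,
   forall s p q, p <= q -> g p s <= g q s,
   forall s q, 0 <= g q s <= 1 &
   forall s k, exists n, g (- n%:R) s < k.+1%:R^-1 /\ 1 - k.+1%:R^-1 < g n%:R s].
Proof.
pose B (q : rat) : set R := `]-oo, ratr q]%classic.
have mB q : measurable (B q) by exact: measurable_itv.
have mCB q : measurable (~` B q) by exact: measurableC.
have /choice[f sf] : forall q, exists f, slab_density (B q) f.
  by move=> q; exact: slab_density_ex.
(* The limit 1 at the upper end is the limit 0 for the complements, which also decrease to the empty
   set; [f + f' = 1] converts one into the other. *)
have /choice[f' sf'] : forall q, exists f, slab_density (~` B q) f.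
  by move=> q; exact: slab_density_ex.
have [h sh] := slab_density_ex measurableT.
have Bmono p q : p <= q -> B p `<=` B q.
  by move=> pq y; rewrite /B /= !in_itv/= => /le_trans; apply; rewrite ler_rat.
pose good s := [/\ forall p q, p <= q -> f p s <= f q s,
  forall q, f q s + f' q s = 1,
  forall k, exists n, f (- n%:R) s < k.+1%:R^-1 &
  forall k, exists n, f' n%:R s < k.+1%:R^-1].
have ae_rat (Q : rat -> S -> Prop) : (forall q, {ae mu, forall s, Q q s}) ->
    {ae mu, forall s q, Q q s}.
  move=> aeQ.
  have : {ae mu, forall s (n : nat), if unpickle n is Some q then Q q s else True}.
    apply: ae_foralln => n; case: unpickle => [q|]; first exact: aeQ.
    exact: aeW.
  by apply: filterS => s + q => /(_ (pickle q)); rewrite pickleK.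
have : {ae mu, forall s, good s}.
  have h1 : {ae mu, forall s p q, p <= q -> f p s <= f q s}.
    apply: (ae_rat) => p; apply: (ae_rat) => q.
    have [pq|pq] := boolP (p <= q); last exact: aeW.
    by have := slab_density_le (mB p) (mB q) (Bmono _ _ pq) (sf p) (sf q); exact: filterS.
  have h2 : {ae mu, forall s q, f q s + f' q s = 1}.
    apply: (ae_rat) => q.
    have := slab_densityT sh.
    have := slab_densityD (mB q) (mCB q) (setICr _) (sf q) (sf' q) (h := h).
    rewrite setUCr => /(_ sh); apply: filterS2 => s + hs; by rewrite hs.
  have h3 : {ae mu, forall s k, exists n, f (- n%:R) s < k.+1%:R^-1}.
    apply: (@slab_density_cvg0 (fun n => B (- n%:R))) => //.
    - move=> m n mn; apply/subsetPset; apply: Bmono.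
      by rewrite lerN2 ler_nat.
    - rewrite -subset0 => y h'; have := h' (Num.truncn `|y|).+1 I.
      rewrite /B /= in_itv/= rmorphN/= ratr_nat => h''.
      have := truncnS_gt `|y|; have := ler_norm (- y); rewrite normrN; lra.
  have h4 : {ae mu, forall s k, exists n, f' n%:R s < k.+1%:R^-1}.
    apply: (@slab_density_cvg0 (fun n => ~` B n%:R)) => //.
    - move=> m n mn; apply/subsetPset; apply: subsetC; apply: Bmono.
      by rewrite ler_nat.
    - rewrite -subset0 => y h'; have := h' (Num.truncn `|y|).+1 I.
      rewrite /B /= in_itv/= ratr_nat => /negP; rewrite -ltNge.
      by have := truncnS_gt `|y|; have := ler_norm y; lra.
  apply: (filterS _ (filterI (filterI h1 h2) (filterI h3 h4))).
  by move=> s [[? ?] [? ?]]; split.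
move=> [N [mN N0 goodN]].
(* On the null set, the distribution function of the Dirac mass at 0. *)
pose g q s := if s \in N then ((0 <= q)%R%:R : R) else f q s.
have g_out q s : ~ N s -> g q s = f q s.
  by move=> Ns; rewrite /g ifN// notin_setE.
have g_in q s : N s -> g q s = (0 <= q)%R%:R.
  by move=> Ns; rewrite /g mem_set.
have goodP s : ~ N s -> good s by apply: contra_notP; exact: goodN.
have mg q : measurable_fun setT (g q).
  apply: measurable_fun_ifT => //; last by have [] := sf q.
  apply: (measurable_fun_bool true); rewrite setTI.
  by rewrite (_ : _ @^-1` _ = N)//; apply/seteqP; split => s /=; [exact: set_mem|exact: mem_set].
exists g; split => //.
- move=> q A mA; have [mf f0 ->//] := sf q.
  apply: ge0_ae_eq_integral => //.
  + by apply: measurable_funTS; exact/measurable_EFinP.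
  + by apply: measurable_funTS; exact/measurable_EFinP.
  + by move=> s _; rewrite lee_fin.
  + by move=> s _; rewrite lee_fin /g; case: ifP.
  + exists N; split => // s /=; apply: contra_notP => Ns _.
    by rewrite g_out.
- move=> s p q pq; have [Ns|Ns] := pselect (N s).
    rewrite !g_in// ler_nat; case: (leP 0 p) => // p0.
    by rewrite (le_trans p0 pq).
  by rewrite !g_out//; have [+ _ _ _] := goodP _ Ns; exact.
- move=> s q; have [Ns|Ns] := pselect (N s).
    by rewrite !g_in// ler0n lern1; case: (0 <= q).
  have [_ /(_ q) fq _ _] := goodP _ Ns; rewrite g_out//.
  have [_ f0 _] := sf q; have [_ f'0 _] := sf' q.
  by rewrite f0/= -fq lerDl.
- move=> s k; have [Ns|Ns] := pselect (N s).
    have k0 : 0 < k.+1%:R^-1 :> R by rewrite invr_gt0.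
    exists 1%N; rewrite !g_in// (_ : (0 <= - 1%:R :> rat) = false)//.
    by rewrite (_ : (0 <= 1%:R :> rat) = true)//; split; rewrite /= ?ltrBlDr ?ltrDl.
  have [mono fq /(_ k)[n nk] /(_ k)[m mk]] := goodP _ Ns.
  exists (maxn m n); rewrite !g_out//; split.
    by apply: le_lt_trans nk; apply: mono; rewrite lerN2 ler_nat leq_maxr.
  apply: (@lt_le_trans _ _ (f m%:R s)).
    move: mk (fq m%:R); move: (f _ s) (f' _ s) (k.+1%:R^-1) => a b c; lra.
  by apply: mono; rewrite ler_nat leq_maxl.
Qed.

Let cvg_lt0 (g : rat -> S -> R) s (y : R) (q : nat -> rat) :
    (forall s p q, p <= q -> g p s <= g q s) -> (forall s q, 0 <= g q s <= 1) ->
    (forall n, y < ratr (q n) < y + n.+1%:R^-1) ->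
  (g (q n) s)%:E @[n --> \oo] -->
    (inf [set g p s | p in [set p : rat | y < ratr p]])%:E.
Proof.
move=> g_nd g01 yq; set A := [set g p s | p in _].
have A0 : has_inf A.
  split; first by exists (g (q 0%N) s), (q 0%N) => //; have /andP[] := yq 0%N.
  by exists 0 => _ [p _ <-]; have /andP[] := g01 s p.
apply/fine_cvgP; split; first exact: nearW.
apply/cvgrPdist_le => e e0.
have [_ [p yp <-] gp] := inf_adherent e0 A0.
have p0 : 0 < ratr p - y by rewrite subr_gt0.
near=> n => /=; rewrite distrC ger0_norm; last first.
  rewrite subr_ge0; apply: ge_inf; first exact: A0.2.
  by exists (q n) => //; have /andP[] := yq n.
rewrite lerBlDl; apply: le_trans (ltW gp); apply: g_nd.
rewrite -(ler_rat R); have /andP[_ /ltW] := yq n; move/le_trans; apply.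
rewrite -lerBrDl; apply: ltW.
by near: n; exact: (near_infty_natSinv_lt (PosNum p0)).
Unshelve. all: by end_near. Qed.

(** The rational densities give a probability [k0 s] at every [s]. The sets [B] for which [k0] is
    measurable and disintegrates [J] form a Dynkin class; it contains the closed lower rays, where
    both facts are limits along rationals decreasing to the endpoint. *)
Theorem disintegration : exists k : R.-pker S ~> R, forall A B,
  measurable A -> measurable B ->
  (J (A `*` B) = \int[mu]_(s in A) k s B)%E.
Proof.
have [g [mg gE g_nd g01 g_lim]] := density_rat.
have /choice[k0 k0E] : forall s, exists P : probability R R, forall y : R,
    P `]-oo, y]%classic = (inf [set g q s | q in [set q : rat | y < ratr q]])%:E.
  move=> s; apply: probability_of_rational_cdf => // p q.
  exact: g_nd.
pose Good B := measurable_fun setT (k0 ^~ B) /\ forall A, measurable A ->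
  (J (A `*` B) = \int[mu]_(s in A) k0 s B)%E.
have GoodT : Good setT.
  split.
    rewrite (_ : k0 ^~ _ = cst 1%E)//; apply/funext => s.
    by rewrite probability_setT.
  move=> A mA; under eq_integral do rewrite probability_setT.
  by rewrite integral_cst// mul1e.
have GoodC B : measurable B -> Good B -> Good (~` B).
  move=> mB [mkB kB].
  have mkC : measurable_fun setT (k0 ^~ (~` B)).
    rewrite (_ : k0 ^~ _ = (fun s => 1 - k0 s B)%E); first exact: emeasurable_funB.
    by apply/funext => s; rewrite probability_setC.
  split=> // A mA.
  have mAB : measurable (A `*` B) by exact: measurableX.
  have AB : (J (A `*` B) + J (A `*` ~` B) = mu A)%E.
    rewrite -measureU//; last 2 first.
    - by apply: measurableX => //; exact: measurableC.
    - by rewrite -subset0 => -[s y] /= [[_ By] [_]].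
    rewrite slab_measureE; congr (J _); apply/seteqP; split => -[s y] /=; first by tauto.
    by move=> [As _]; have [By|By] := pselect (B y); tauto.
  have AB' : (\int[mu]_(s in A) k0 s B + \int[mu]_(s in A) k0 s (~` B) = mu A)%E.
    rewrite -ge0_integralD//; last 2 first.
    - exact: measurable_funTS.
    - exact: measurable_funTS.
    transitivity (\int[mu]_(s in A) cst 1 s)%E; last by rewrite integral_cst// mul1e.
    apply: eq_integral => s _; rewrite probability_setC//.
    by rewrite addeC subeK// fin_num_measure.
  move: AB'; rewrite -kB// -AB => h.
  have JAB : J (A `*` B) \is a fin_num by exact: fin_num_measure.
  transitivity (J (A `*` B) + J (A `*` ~` B) - J (A `*` B))%E.
    by rewrite addeAC subee// add0e.
  by rewrite -h addeAC subee// add0e.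
have GoodU (B : nat -> set R) : (forall n, measurable (B n)) -> trivIset setT B ->
    (forall n, Good (B n)) -> Good (\bigcup_n B n).
  move=> mB tB gB.
  have kU s : k0 s (\bigcup_n B n) = (\sum_(n <oo) k0 s (B n))%E.
    by rewrite measure_bigcup//; apply: eq_eseriesl => n; rewrite in_setT.
  split.
    rewrite (_ : k0 ^~ _ = (fun s => \sum_(0 <= n <oo | n \in xpredT) k0 s (B n)))%E.
      by apply: ge0_emeasurable_sum => // n _; have [] := gB n.
    by apply/funext => s; exact: kU.
  move=> A mA; under eq_integral do rewrite kU.
  rewrite integral_nneseries//; last first.
    by move=> n; apply: measurable_funTS; have [] := gB n.
  have -> : A `*` \bigcup_n B n = \bigcup_n (A `*` B n).
    apply/seteqP; split => [[s y] /= [As [n _ By]]|[s y] [n _ /= [As By]]].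
      by exists n.
    by split => //; exists n.
  rewrite measure_bigcup//; last 2 first.
  - by move=> n _; exact: measurableX.
  - apply/trivIsetP => i j _ _ ij; rewrite -subset0 => -[s y] /= [[_ Bi] [_ Bj]].
    by have /trivIsetP/(_ i j I I ij) := tB; rewrite -subset0 => /(_ y); exact.
  rewrite (@eq_eseriesl _ _ predT) => [|n]; last by rewrite in_setT.
  by apply: eq_eseriesr => n _; have [_ kn] := gB n; exact: kn.
have Good_itv (y : R) : Good `]-oo, y]%classic.
  have /choice[q yq] : forall n, exists p : rat, y < ratr p < y + n.+1%:R^-1.
    move=> n; have yn : y < y + n.+1%:R^-1 by rewrite ltrDl.
    by have [p] := rat_in_itvoo yn; rewrite in_itv/=; exists p.
  have gk s : (g (q n) s)%:E @[n --> \oo] --> k0 s `]-oo, y]%classic.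
    by rewrite k0E; exact: cvg_lt0.
  have mgE n : measurable_fun setT (fun s => (g (q n) s)%:E).
    exact/measurable_EFinP.
  split.
    by apply: (emeasurable_fun_cvg _ _ mgE) => s _; exact: gk.
  move=> A mA.
  have c1 : (\int[mu]_(s in A) (g (q n) s)%:E)%E @[n --> \oo] -->
      (\int[mu]_(s in A) k0 s `]-oo, y]%classic)%E.
    apply: (@dominated_cvg _ _ _ mu A mA _ _ (cst 1%E)) => //.
    - by move=> n; exact: measurable_funTS.
    - by apply: (@integrableS _ _ _ mu setT) => //; exact: finite_measure_integrable_cst.
    - move=> n s _; rewrite lee_fin ger0_norm; by have /andP[] := g01 s (q n).
  have mAq n : measurable (A `*` `]-oo, ratr (q n)]%classic : set (S * R)).
    exact: measurableX.
  have mAy : measurable (A `*` `]-oo, y]%classic) by exact: measurableX.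
  have c2 : J (A `*` `]-oo, ratr (q n)]%classic) @[n --> \oo] -->
      J (A `*` `]-oo, y]%classic).
    have mAu n : measurable (A `*` `]-oo, y + n.+1%:R^-1]%classic : set (S * R)).
      exact: measurableX.
    apply: (@squeeze_cvge _ _ _ _ (cst (J (A `*` `]-oo, y]%classic))) _
      (fun n => J (A `*` `]-oo, y + n.+1%:R^-1]%classic))).
    - near=> n; have /andP[yqn qyn] := yq n.
      apply/andP; split; apply: le_measure; rewrite ?inE//.
        move=> [s z] /= []; rewrite ?in_itv/= => As zy; split => //.
        by rewrite ?in_itv/= (le_trans zy)// ltW.
      move=> [s z] /= []; rewrite ?in_itv/= => As zy; split => //.
      by rewrite ?in_itv/= (le_trans zy)// ltW.
    - exact: cvg_cst.
    - have -> : A `*` `]-oo, y]%classic = \bigcap_n (A `*` `]-oo, y + n.+1%:R^-1]%classic).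
        apply/seteqP; split => [[s z] /= [As]|[s z] h].
          rewrite ?in_itv/= => zy n _; split => //=.
          by rewrite ?in_itv/= (le_trans zy)// lerDl.
        have [As _] := h 0%N I; split => //=; rewrite ?in_itv/=.
        apply/ler_addgt0Pr => e e0.
        have [n _ /(_ n (leqnn n))/= /ltW ne] := near_infty_natSinv_lt (PosNum e0).
        have [_ /=] := h n I; rewrite ?in_itv/= => /le_trans; apply.
        by rewrite lerD2l.
      apply: nonincreasing_cvg_mu => //.
      + by rewrite ltey_eq fin_num_measure.
      + exact: bigcapT_measurable.
      + move=> m n mn; apply/subsetPset => -[s z] /= []; rewrite ?in_itv/= => As zy.
        split=> //; apply: (le_trans zy); rewrite lerD2l lef_pV2 ?posrE//.
        by rewrite ler_nat ltnS.
  have gEA : (fun n => \int[mu]_(s in A) (g (q n) s)%:E)%E =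
      (fun n => J (A `*` `]-oo, ratr (q n)]%classic)).
    by apply/funext => n; rewrite gE.
  by rewrite gEA in c1; exact: (cvg_unique _ c2 c1).
have bE : (measurable : set (set R)) = <<s measurable_realfun.RGenOInfty.G (R := R) >>.
  exact: measurable_realfun.RGenOInfty.measurableE.
have GoodB B : measurable B -> Good B.
  move=> mB; apply: (dynkin_induction bE) => //.
  - move=> _ _ [a ->] [b ->]; exists (Num.max a b).
    by apply/seteqP; split => x /=; rewrite ?in_itv/= !andbT gt_max; [case=> -> ->|move/andP].
  - move=> _ [x ->]; rewrite -setCitvl; apply: GoodC => //.
  - by rewrite -bE.
pose k1 : R.-ker S ~> R := HB.pack (k0 : S -> {measure set R -> \bar R})
  (isKernel.Build _ _ S R R (k0 : S -> {measure set R -> \bar R}) (fun B mB => (GoodB B mB).1)).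
pose k : R.-pker S ~> R := HB.pack (Kernel.sort k1)
  (Kernel_isProbability.Build _ _ S R R (Kernel.sort k1) (fun s => probability_setT (k0 s))).
exists k => A B mA mB; exact: (GoodB B mB).2.
Unshelve. all: by end_near. Qed.

End disintegration.

(** * Conditional laws *)

Section integral_kernel.
Local Open Scope ereal_scope.
Context d d' {S : measurableType d} {T : measurableType d'} {R : realType}.

Lemma ge0_integral_mrestr (m : {measure set S -> \bar R}) D (mD : measurable D)
    (f : S -> \bar R) : measurable_fun setT f -> (forall s, 0 <= f s) ->
  \int[mrestr m mD]_s f s = \int[m]_(s in D) f s.
Proof.
move=> mf f0; rewrite (ge0_negligible_integral (measurableC mD) measurableT)//; last first.
  by rewrite /= /mrestr setICl measure0.
rewrite setTD setCK; apply: eq_measure_integral => A mA AD.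
by rewrite /= /mrestr (setIidl AD).
Qed.

Variables (m : {finite_measure set S -> \bar R}) (k : R.-pker S ~> T).

(** As a kernel from the one-point space, [m] can be composed with [k], and the integration formula
    for composed kernels becomes available. *)
Let cst_kernel : R.-ker unit ~> S := HB.pack (fun _ : unit => (m : {measure set S -> \bar R}))
  (isKernel.Build _ _ unit S R (fun _ => m : {measure set S -> \bar R})
    (fun U mU => measurable_cst (m U))).

Let cst_uub : measure_fam_uub cst_kernel.
Proof.
exists (fine (m setT) + 1)%R => u.
by rewrite EFinD fineK ?fin_num_measure// lteDl ?fin_num_measure.
Qed.

Let cst_fkernel : R.-fker unit ~> S := HB.pack (Kernel.sort cst_kernel)
  (Kernel_isFinite.Build _ _ unit S R (Kernel.sort cst_kernel) cst_uub).

Lemma ge0_integral_kernel (nu : {measure set T -> \bar R}) (f : T -> \bar R) :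
  (forall B, measurable B -> nu B = \int[m]_s k s B) ->
  measurable_fun setT f -> (forall y, 0 <= f y) ->
  \int[nu]_y f y = \int[m]_s \int[k s]_y f y.
Proof.
move=> nuE mf f0.
transitivity (\int[kcomp cst_fkernel (kernel.kernel_snd k) tt]_y f y).
  by apply: eq_measure_integral => B mB _; rewrite nuE.
by rewrite integral_kcomp.
Qed.

End integral_kernel.

Section trim.
Context d {Omega : measurableType d} {R : realType} (P : probability Omega R).
Variables (F : set (set Omega)) (sF : Defs.sub_sigma_algebra F).

Lemma sub_sigma_algebraE : (measurable : set (set (g_sigma_algebraType F))) = F.
Proof. by have [sF' _] := sF; exact: smallest_id. Qed.

Let FE := sub_sigma_algebraE.

Lemma measurable_trim_id :
  measurable_fun setT (id : Omega -> g_sigma_algebraType F).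
Proof. by move=> _ A; rewrite FE setTI => FA; exact: sF.2. Qed.

Let trim_id : {mfun Omega >-> g_sigma_algebraType F} :=
  HB.pack (id : Omega -> g_sigma_algebraType F)
    (isMeasurableFun.Build _ _ _ _ _ measurable_trim_id).

(** The restriction of [P] to [F], as the image of [P] under the identity, which is measurable
    towards the smaller sigma-algebra. *)
Definition trim : probability (g_sigma_algebraType F) R := distribution P trim_id.


Lemma measurable_wrt_measurable d' (T : measurableType d') (f : Omega -> T) :
  measurable_fun setT (f : g_sigma_algebraType F -> T) -> measurable_fun setT f.
Proof. by move=> mf; exact: (measurableT_comp mf measurable_trim_id). Qed.

Lemma ge0_integral_trim (A : set Omega) (f : Omega -> \bar R) : F A ->
  measurable_fun setT (f : g_sigma_algebraType F -> \bar R) ->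
  (forall w, 0 <= f w)%E ->
  (\int[trim]_(w in A) f w = \int[P]_(w in A) f w)%E.
Proof.
move=> FA mf f0; rewrite ge0_integral_pushforward//.
- by rewrite FE.
- exact: measurable_funTS.
Qed.

Lemma integrable_trim (f : Omega -> \bar R) :
  measurable_fun setT (f : g_sigma_algebraType F -> \bar R) ->
  P.-integrable setT f -> trim.-integrable setT f.
Proof.
by move=> mf intf; apply: integrable_pushforward.
Qed.

Lemma integral_trim (A : set Omega) (f : Omega -> \bar R) : F A ->
  measurable_fun setT (f : g_sigma_algebraType F -> \bar R) ->
  P.-integrable setT f ->
  (\int[trim]_(w in A) f w = \int[P]_(w in A) f w)%E.
Proof.
move=> FA mf intf; apply: integral_pushforward => //.
- by apply: integrableS intf => //; exact: sF.2.
- by rewrite FE.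
Qed.

Lemma ae_trim (Q : Omega -> Prop) :
  {ae trim, forall w, Q w} -> {ae P, forall w, Q w}.
Proof. by move=> [N [mN N0 QN]]; exists N; split => //; apply: sF.2; rewrite -FE. Qed.

(** Disintegration of the law of [w |-> (w, X w)], where the first factor carries [F] only. *)
Lemma regular_cond_law (X : Omega -> R) : measurable_fun setT X ->
  exists k : R.-pker (g_sigma_algebraType F) ~> R, is_cond_law P X k.
Proof.
move=> mX; pose j w : (g_sigma_algebraType F * R)%type := (w, X w).
have mj : measurable_fun setT j.
  by apply/measurable_fun_pairP; split => //; exact: measurable_trim_id.
pose jm : {mfun Omega >-> (g_sigma_algebraType F * R)%type} :=
  HB.pack j (isMeasurableFun.Build _ _ _ _ _ mj).
have [k kE] := disintegration (distribution P jm).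
exists k => A B FA mB.
have mA : measurable (A : set (g_sigma_algebraType F)) by rewrite FE.
transitivity (distribution P jm (A `*` B)).
  by rewrite /distribution /pushforward; congr (P _).
rewrite kE// -ge0_integral_trim//; last exact: measurable_kernel.
apply: eq_measure_integral => C mC _.
congr (P _); by apply/seteqP; split => w /= => [[]|].
Qed.

End trim.

Section cond_law.
Local Open Scope ereal_scope.
Context d {Omega : measurableType d} {R : realType} (P : probability Omega R).
Variables (F : set (set Omega)) (sF : Defs.sub_sigma_algebra F).
Variables (X : Omega -> R) (mX : measurable_fun setT X).
Variables (k : R.-pker (g_sigma_algebraType F) ~> R) (kX : is_cond_law P X k).

(** By the definition of a conditional law, the image under [X] of [P] restricted to [A] is the
    trimmed measure restricted to [A] and composed with [k]; [ge0_integral_kernel] passes from sets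
    to functions. *)
Lemma ge0_integral_cond_law (A : set Omega) (f : R -> \bar R) : F A ->
  measurable_fun setT f -> (forall y, 0 <= f y) ->
  \int[P]_(w in A) f (X w) = \int[P]_(w in A) \int[k w]_y f y.
Proof.
move=> FA mf f0.
have mA : measurable A by exact: sF.2.
have mA' : measurable (A : set (g_sigma_algebraType F)).
  by rewrite (sub_sigma_algebraE sF).
have mk : measurable_fun setT
    (fun w : g_sigma_algebraType F => \int[k w]_y f y).
  by apply: measurable_fun_integral_kernel => // U mU; exact: measurable_kernel.
have k0 w : 0 <= \int[k w]_y f y by apply: integral_ge0 => y _; exact: f0.
rewrite -[RHS](ge0_integral_trim P sF)// -[RHS](ge0_integral_mrestr _ mA')//.
rewrite -[LHS](ge0_integral_mrestr _ mA)//; last exact: measurableT_comp.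
have fin : (trim P sF A < +oo) by rewrite ltey_eq fin_num_measure.
rewrite -(@ge0_integral_kernel _ _ _ _ _ (mfrestr mA' fin) k
  (pushforward (mrestr P mA) X))//.
  by rewrite ge0_integral_pushforward.
move=> B mB; transitivity (P (A `&` X @^-1` B)).
  by rewrite setIC.
rewrite kX// -[LHS](ge0_integral_trim P sF)//; last exact: measurable_kernel.
by rewrite -[LHS](ge0_integral_mrestr _ mA')//; exact: measurable_kernel.
Qed.

End cond_law.

(** * Envelopes *)

Section linearly_bounded_functions.
Context {R : realType}.
Implicit Types (g : R -> R) (rho : probability R R).

Lemma continuous_measurable g : continuous g -> measurable_fun setT g.
Proof. by move=> cg; apply: continuous_measurable_fun. Qed.

Lemma linearly_bounded_integrable rho g : continuous g -> linearly_bounded g ->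
  finite_first_moment rho -> rho.-integrable setT (EFin \o g).
Proof.
move=> cg [C C0 gC] rho1.
have i1 : rho.-integrable setT (EFin \o (fun y => C * (1 + `|y|))).
  have /integrable_norm i : rho.-integrable setT (EFin \o (idfun : R -> R)) := rho1.
  have := integrableZl measurableT C (integrableD measurableT
    (finite_measure_integrable_cst rho 1 measurableT) i).
  by apply: eq_integrable.
apply: le_integrable i1 => //.
- by apply/measurable_EFinP; exact: continuous_measurable.
- move=> y _ /=; rewrite lee_fin [leRHS]ger0_norm//.
  by rewrite mulr_ge0// ltW.
Qed.

Lemma linearly_bounded_shift g t :
  linearly_bounded g -> linearly_bounded (fun y => g (t + y)).
Proof.
move=> [C C0 gC]; exists (C * (1 + `|t|)); first by rewrite mulr_gt0// ltr_wpDr.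
move=> y; apply: le_trans (gC _) _; rewrite -mulrA; apply: ler_wpM2l; first exact: ltW.
rewrite mulrDl mul1r mulrDr mulr1.
by have := ler_normD t y; have := mulr_ge0 (normr_ge0 t) (normr_ge0 y); lra.
Qed.

End linearly_bounded_functions.

Section shift.
Context {R : realType} (rho : probability R R) (t : R).

Let shift : {mfun R >-> R} := HB.pack (fun y : R => t + y)
  (isMeasurableFun.Build _ _ _ _ (fun y : R => t + y)
    (measurable_funD (measurable_cst t) (@measurable_id _ _ setT))).

(** Translation carries the maximum of the support along with its mass, so a competitor in the
    envelope at one point can be moved to any other point. *)
Definition shift_probability : probability R R := distribution rho shift.

Lemma shift_probability_integral (f : R -> R) :
  measurable_fun setT f -> rho.-integrable setT (fun y => (f (t + y))%:E) ->
  (\int[shift_probability]_y (f y)%:E = \int[rho]_y (f (t + y))%:E)%E.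
Proof. by move=> mf intf; rewrite integral_pushforward//; exact/measurable_EFinP. Qed.

Let shift_continuous (s : R) : continuous (fun y : R => s + y).
Proof. by move=> y; apply: cvgD; [exact: cvg_cst|exact: cvg_id]. Qed.

Lemma supp_shift (y : R) : supp shift_probability (t + y) = supp rho y.
Proof.
apply/propext; split => h U [oU Uy].
- have -> : U = (fun z => t + z) @^-1` ((fun z => - t + z) @^-1` U).
    by apply/seteqP; split => z /=; rewrite addrA addNr add0r.
  apply: h; split; last by rewrite /= addrA addNr add0r.
  by apply: open_comp => // z _; exact: shift_continuous.
- apply: (h (shift @^-1` U)); split => //.
  by apply: open_comp => // z _; exact: shift_continuous.
Qed.

Lemma max_supp_shift (y : R) : max_supp shift_probability (t + y) = max_supp rho y.
Proof.
rewrite /max_supp /setI/= supp_shift; congr (_ /\ _); apply/propext; split => h z hz.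
- by rewrite -(lerD2l t); apply: h; rewrite supp_shift.
- rewrite -(subrK t z) addrC lerD2l; apply: h.
  by rewrite -supp_shift addrC subrK.
Qed.

Lemma biased_shift beta : biased beta rho -> biased beta shift_probability.
Proof.
rewrite /biased => /le_trans; apply; rewrite /shift_probability /distribution /pushforward.
rewrite le_eqVlt; apply/orP; left; apply/eqP; congr (rho _).
by apply/funext => y /=; rewrite max_supp_shift.
Qed.

Lemma finite_first_moment_shift :
  finite_first_moment rho -> finite_first_moment shift_probability.
Proof.
move=> rho1; apply: integrable_pushforward => //.
rewrite preimage_setT.
have := integrableD measurableT (finite_measure_integrable_cst rho t measurableT) rho1.
by apply: eq_integrable.
Qed.

Lemma has_mean_shift x : finite_first_moment rho -> has_mean rho x ->
  has_mean shift_probability (t + x).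
Proof.
move=> rho1 mx; rewrite /has_mean shift_probability_integral//; last first.
  have := integrableD measurableT (finite_measure_integrable_cst rho t measurableT) rho1.
  by apply: eq_integrable.
under eq_integral do rewrite EFinD.
rewrite integralD//; last exact: finite_measure_integrable_cst.
have tE : (\int[rho]_y t%:E = t%:E)%E.
  rewrite integral_cst//.
  by rewrite -[RHS]mule1; congr (_ * _)%E; exact: probability_setT.
by rewrite [X in (_ + X)%E]mx tE EFinD.
Qed.

End shift.

Section envelope.
Context {R : realType} (beta : R) (g : R -> R).
Hypotheses (cg : continuous g) (lg : linearly_bounded g).

(** A competitor at [x] of cost below [c], translated by [z - x], is a competitor at [z]. Its cost
    depends continuously on [z]: for translations by less than 1 the integrands are dominated by
    [C (2 + |y|)]. *)
Lemma envelope_lt_open c : open [set x | envelope beta g x < c%:E]%E.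
Proof.
rewrite openE => x /= /ereal_inf_lt[_ [rho [rho1 mx b] <-] ltc].
pose f t := \int[rho]_y g (t + y).
have cgs t : continuous (fun y => g (t + y)).
  move=> y; apply: (@continuous_comp _ _ _ (fun y => t + y) g); last exact: cg.
  by apply: cvgD; [exact: cvg_cst|exact: cvg_id].
have int t : rho.-integrable setT (EFin \o (fun y => g (t + y))).
  by apply: linearly_bounded_integrable => //; exact: linearly_bounded_shift.
have cf : {for 0, continuous f}.
  have [C C0 gC] := lg.
  have h1 : {ae rho, forall y, setT y -> {in `](-1), 1[%classic, continuous (fun t => g (t + y))}}.
    apply: aeW => y _ t _.
    apply: (@continuous_comp _ _ _ (fun t => t + y) g); last exact: cg.
    by apply: cvgD; [exact: cvg_id|exact: cvg_cst].
  have h2 : rho.-integrable setT (EFin \o (fun y => C * (2 + `|y|))).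
    have /integrable_norm i : rho.-integrable setT (EFin \o (idfun : R -> R)) := rho1.
    have := integrableZl measurableT C (integrableD measurableT
      (finite_measure_integrable_cst rho 2 measurableT) i).
    by apply: eq_integrable.
  have h3 t : `](-1), 1[%classic t ->
      {ae rho, forall y, setT y -> `|g (t + y)| <= C * (2 + `|y|)}.
    rewrite /= in_itv/= => /andP[t1 t2]; apply: aeW => y _.
    apply: (le_trans (gC _)); apply: ler_wpM2l; first exact: ltW.
    have : `|t| <= 1 by rewrite ler_norml !ltW.
    by have := ler_normD t y; lra.
  apply: (continuity_under_integral measurableT (fun t _ => int t) h1 h2 h3).
  by rewrite inE/= in_itv/= ltrN10 ltr01.
have f0c : f 0 < c.
  move: ltc; rewrite /f /Rintegral -lte_fin fineK; last first.
    by apply: integrable_fin_num => //; exact: int.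
  by under [in X in _ -> X]eq_integral do rewrite add0r.
have cfx : f (z - x) @[z --> x] --> f 0.
  have zx : z - x @[z --> x] --> x - x.
    by apply: cvgB; [exact: cvg_id|exact: cvg_cst].
  by rewrite subrr in zx; exact: (cvg_comp _ _ zx cf).
move/cvgr_lt : cfx => /(_ _ f0c); apply: filterS => z /= fz.
apply: (@le_lt_trans _ _ (f (z - x))%:E); last by rewrite lte_fin.
apply: ereal_inf_lbound.
exists (shift_probability rho (z - x)).
  split; [exact: finite_first_moment_shift| |exact: biased_shift].
  by rewrite -[X in has_mean _ X](subrK x z); exact: has_mean_shift.
rewrite shift_probability_integral; last 2 first.
- exact: continuous_measurable.
- exact: int.
by rewrite /f /Rintegral fineK//; apply: integrable_fin_num => //; exact: int.
Qed.

Lemma measurable_envelope : measurable_fun setT (envelope beta g).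
Proof.
have h : measurable_fun setT (fun x => - envelope beta g x)%E.
  apply: lower_semicontinuous_measurable; apply/lower_semicontinuousP => a.
  have -> : [set x | a%:E < - envelope beta g x]%E =
      [set x | envelope beta g x < (- a)%:E]%E.
    by apply/seteqP; split => x /=; rewrite EFinN lteNr.
  exact: envelope_lt_open.
rewrite (_ : envelope beta g = (fun x => - - envelope beta g x)%E).
  exact: measurableT_comp.
by apply/funext => x; rewrite oppeK.
Qed.

End envelope.

(** * Biased martingales and the biased order *)

Section cond_law_integral.
Local Open Scope ereal_scope.
Context d {Omega : measurableType d} {R : realType} (P : probability Omega R).
Variables (F : set (set Omega)) (sF : Defs.sub_sigma_algebra F).
Variables (X : Omega -> R) (mX : measurable_fun setT X).
Variables (k : R.-pker (g_sigma_algebraType F) ~> R) (kX : is_cond_law P X k).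
Variables (f : R -> R) (mf : measurable_fun setT f).
Hypothesis intf : P.-integrable setT (EFin \o (f \o X)).

Let FT : F setT.
Proof. by rewrite -(sub_sigma_algebraE sF); exact: measurableT. Qed.

Let measurable_ge0 (h : R -> \bar R) : measurable_fun setT h -> (forall y, 0 <= h y) ->
  measurable_fun setT (fun w : g_sigma_algebraType F => \int[k w]_y h y).
Proof.
by move=> mh h0; apply: measurable_fun_integral_kernel => // U mU; exact: measurable_kernel.
Qed.

Let integrable_ge0 (h : R -> \bar R) : measurable_fun setT h -> (forall y, 0 <= h y) ->
  P.-integrable setT (h \o X) -> P.-integrable setT (fun w => \int[k w]_y h y).
Proof.
move=> mh h0 /integrableP[_ inth]; apply/integrableP; split.
  exact: (measurable_wrt_measurable sF (measurable_ge0 mh h0)).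
have k0 w : 0 <= \int[k w]_y h y by apply: integral_ge0 => y _; exact: h0.
under eq_integral do rewrite gee0_abs//.
rewrite -(ge0_integral_cond_law sF mX kX)//.
by under eq_integral do rewrite -[h _]gee0_abs//.
Qed.

Let mEf : measurable_fun setT (EFin \o f). Proof. exact/measurable_EFinP. Qed.

Lemma cond_law_integrable :
  {ae trim P sF, forall w, (k w).-integrable setT (EFin \o f)}.
Proof.
have h0 y : 0 <= `|(f y)%:E| by exact: abse_ge0.
have mh : measurable_fun setT (fun y => `|(f y)%:E|) by exact: measurableT_comp.
have := integrable_ge0 mh h0 (integrable_abse intf).
move/(integrable_trim sF (measurable_ge0 mh h0))/(integrable_ae measurableT).
apply: filterS => w /(_ I) kw; apply/integrableP; split => //.
by rewrite -ge0_fin_numE//; apply: integral_ge0 => y _; exact: h0.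
Qed.

(** The real integral is [fine] of a difference of two nonnegative kernel integrals, hence
    measurable without excluding the points where [f] is not integrable under [k w]. *)
Lemma measurable_cond_law_integral : measurable_fun setT
  (fun w : g_sigma_algebraType F => \int[k w]_y (f y))%R.
Proof.
pose h w := \int[k w]_y (EFin \o f)^\+ y - \int[k w]_y (EFin \o f)^\- y.
rewrite (_ : (fun _ => _) = fine \o h); last first.
  by apply/funext => w; rewrite /Rintegral/= /h -integralE.
apply: measurableT_comp => //.
by apply: emeasurable_funB; apply: measurable_ge0 => //;
  [exact: measurable_funepos|exact: measurable_funeneg].
Qed.

Let cond_law_integralE : {ae P, forall w : Omega, (\int[k w]_y (f y))%R%:E =
  \int[k w]_y (EFin \o f)^\+ y - \int[k w]_y (EFin \o f)^\- y}.
Proof.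
have [N [mN N0 kN]] := ae_trim cond_law_integrable.
exists N; split => //; apply: subset_trans kN => w /=; apply: contra_not => kw.
by rewrite -integralE fineK//; exact: integrable_fin_num.
Qed.

Let intp : P.-integrable setT (fun w => \int[k w]_y (EFin \o f)^\+ y).
Proof.
apply: integrable_ge0 => //; first exact: measurable_funepos.
by apply: eq_integrable (integrable_funepos measurableT intf) => // w _; rewrite funepos.unlock.
Qed.

Let intn : P.-integrable setT (fun w => \int[k w]_y (EFin \o f)^\- y).
Proof.
apply: integrable_ge0 => //; first exact: measurable_funeneg.
by apply: eq_integrable (integrable_funeneg measurableT intf) => // w _; rewrite funeneg.unlock.
Qed.

Lemma integrable_cond_law_integral :
  P.-integrable setT (fun w => (\int[k w]_y (f y))%R%:E).
Proof.
have h0 y : 0 <= `|(f y)%:E| by exact: abse_ge0.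
have mh : measurable_fun setT (fun y => `|(f y)%:E|) by exact: measurableT_comp.
apply: le_integrable (integrable_ge0 mh h0 (integrable_abse intf)) => //.
  apply/measurable_EFinP.
  exact: (measurable_wrt_measurable sF measurable_cond_law_integral).
move=> w _; rewrite [leRHS]gee0_abs; last by apply: integral_ge0 => y _; exact: h0.
apply: le_trans (le_abse_integral _ measurableT mEf).
by rewrite /Rintegral; case: (\int[k w]_y _) => [r| |] //=; rewrite ?normr0 ?leey.
Qed.

Lemma integral_cond_law A : F A ->
  \int[P]_(w in A) (\int[k w]_y (f y))%R%:E = \int[P]_(w in A) (f (X w))%:E.
Proof.
move=> FA; have mA : measurable A by exact: sF.2.
have mp := measurable_funepos mEf; have mn := measurable_funeneg mEf.
transitivity (\int[P]_(w in A)
    (\int[k w]_y (EFin \o f)^\+ y - \int[k w]_y (EFin \o f)^\- y)).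
  apply: ae_eq_integral => //.
  - apply: measurable_funTS; exact: measurable_int integrable_cond_law_integral.
  - by apply: measurable_funTS; apply: emeasurable_funB;
      [exact: measurable_int intp|exact: measurable_int intn].
  - by apply: filterS cond_law_integralE => w + _.
rewrite integralB//; last 2 first.
- exact: integrableS intp.
- exact: integrableS intn.
rewrite -!(ge0_integral_cond_law sF mX kX)// [RHS]integralE.
by congr (_ - _); apply: eq_integral => w _;
  [rewrite funepos.unlock|rewrite funeneg.unlock].
Qed.

End cond_law_integral.

Section probability_of.
Local Open Scope ereal_scope.
Context d {T : measurableType d} {R : realType}.
Variables (m : {measure set T -> \bar R}) (m1 : m setT = 1).

Let f A := m A.

Let f0 : f set0 = 0. Proof. exact: measure0. Qed.

Let f_ge0 A : 0 <= f A. Proof. exact: measure_ge0. Qed.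

Let f_sigma_additive : semi_sigma_additive f.
Proof. exact: measure_semi_sigma_additive. Qed.

Let fm : {measure set T -> \bar R} := HB.pack f
  (isMeasure.Build _ _ _ f f0 f_ge0 f_sigma_additive).

(** The values [k w] of a probability kernel are typed as measures, whereas the competitors in the
    envelope are typed as probabilities. *)
Definition probability_of : probability T R := HB.pack (Measure.sort fm)
  (Measure_isProbability.Build _ _ _ (Measure.sort fm) m1).

End probability_of.

Section necessity.
Local Open Scope ereal_scope.
Context {R : realType}.

Lemma has_law_integral d d' (Omega : measurableType d) (T : measurableType d')
    (P : probability Omega R) (X : Omega -> T) (m : probability T R) (f : T -> \bar R) :
  measurable_fun setT X -> has_law P X m -> measurable_fun setT f ->
  (forall y, 0 <= f y) -> \int[m]_y f y = \int[P]_w f (X w).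
Proof.
move=> mX Xm mf f0; transitivity (\int[pushforward P X]_y f y).
  by apply: eq_measure_integral => B mB _; rewrite [RHS]Xm.
by rewrite ge0_integral_pushforward.
Qed.

(** Positive and negative parts are compared separately, without integrability, since the envelope
    may have integral [-oo]. *)
Lemma integral_le_ae d (Omega : measurableType d) (P : probability Omega R)
    (f g : Omega -> \bar R) : measurable_fun setT f -> measurable_fun setT g ->
  {ae P, forall w, f w <= g w} -> \int[P]_w f w <= \int[P]_w g w.
Proof.
move=> mf mg fg; rewrite [leLHS]integralE [leRHS]integralE; apply: leeB.
- apply: ae_ge0_le_integral => //; try exact: measurable_funepos.
  apply: filterS fg => w fg _; rewrite funepos.unlock.
  by rewrite ge_max !le_max fg lexx orbT.
- apply: ae_ge0_le_integral => //; try exact: measurable_funeneg.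
  apply: filterS fg => w fg _; rewrite funeneg.unlock.
  by rewrite ge_max !le_max leeN2 fg lexx orbT.
Qed.

Lemma Cpl_biased_le (mu nu : probability R R) (beta : R) :
  finite_first_moment nu -> Cpl beta mu nu !=set0 -> biased_le beta mu nu.
Proof.
move=> nu1; case=> rho; case=> d; case=> Omega; case=> P; case=> F0; case=> F1.
case=> X0; case=> X1; case; case=> mart [k kX1 kb] X0mu X1nu _.
move=> g cg lg.
have [sF0 sF1 _ aX0 aX1 iX0 iX1 [_ _ X0E]] := mart.
have mX0 : measurable_fun setT X0 := measurable_wrt_measurable sF0 aX0.
have mX1 : measurable_fun setT X1 := measurable_wrt_measurable sF1 aX1.
have mg : measurable_fun setT g by exact: continuous_measurable.
have menv := measurable_envelope beta cg lg.
have igX1 : P.-integrable setT (EFin \o (g \o X1)).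
  have inu := linearly_bounded_integrable cg lg nu1.
  apply/integrableP; split; first exact/measurable_EFinP/measurableT_comp.
  have /integrableP[_] := inu.
  rewrite (has_law_integral mX1 X1nu)//.
  by apply: measurableT_comp => //; exact/measurable_EFinP.
pose G w := (\int[k w]_y g y)%R.
have mG := measurable_cond_law_integral k mg.
have iG : P.-integrable setT (EFin \o G).
  exact: (integrable_cond_law_integral sF0 mX1 kX1 mg igX1).
have mid : measurable_fun setT (idfun : R -> R) by exact: measurable_id.
have iid : P.-integrable setT (EFin \o (idfun \o X1)) by exact: iX1.
have first_moment : {ae P, forall w : Omega, finite_first_moment (k w)}.
  exact: (ae_trim (cond_law_integrable sF0 mX1 kX1 mid iid)).
(* The mean of [k w] and [X0] are both [F0]-measurable with the same integrals over the sets of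
   [F0], so they agree almost everywhere for the trimmed measure. *)
have mean : {ae P, forall w : Omega, has_mean (k w) (X0 w)}.
  have mm := measurable_cond_law_integral k mid.
  have im := integrable_cond_law_integral sF0 mX1 kX1 mid iid.
  have mm' : measurable_fun setT (fun w : g_sigma_algebraType F0 =>
      (\int[k w]_y idfun y)%R%:E) by exact/measurable_EFinP.
  have aX0' : measurable_fun setT (fun w : g_sigma_algebraType F0 => (X0 w)%:E).
    exact/measurable_EFinP.
  have : ae_eq (trim P sF0) setT (fun w => (\int[k w]_y idfun y)%R%:E)
      (fun w => (X0 w)%:E).
    apply: integral_ae_eq => //.
      exact: integrable_trim.
    move=> A _ mA.
    have F0A : F0 A by rewrite -(sub_sigma_algebraE sF0).
    rewrite integral_trim// integral_trim// (integral_cond_law sF0 mX1 kX1 mid iid)//.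
    by rewrite X0E.
  move=> /ae_trim [N [mN N0 XN]]; have [M [mM M0 kM]] := first_moment.
  exists (N `|` M); split; first exact: measurableU.
    apply/eqP; rewrite eq_le measure_ge0 andbT (le_trans (measureU2 _ mN mM))//.
    by rewrite [X in X + _](N0 : P N = 0) [X in _ + X](M0 : P M = 0) adde0.
  apply: subset_trans (setUSS XN kM) => w /=.
  rewrite -not_andE; apply: contra_not => -[/(_ I) [mw] kw].
  rewrite /has_mean -mw /Rintegral fineK//.
  exact: (@integrable_fin_num _ _ _ (k w) setT measurableT (EFin \o idfun)).
have kg : {ae P, forall w : Omega, (k w).-integrable setT (EFin \o g)}.
  exact: (ae_trim (cond_law_integrable sF0 mX1 kX1 mg igX1)).
have env_le : {ae P, forall w : Omega, envelope beta g (X0 w) <= (G w)%:E}.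
  have kb' : {ae P, forall w : Omega, biased beta (k w)} := kb.
  apply: (filterS _ (filterI (filterI first_moment mean) (filterI kg kb'))).
  move=> w [[k1 km] [kgw kbw]].
  rewrite /G /Rintegral fineK; last exact: integrable_fin_num.
  apply: ereal_inf_lbound.
  by exists (probability_of (prob_kernel (s := k) w)).
have -> : \int[mu]_x envelope beta g x = \int[P]_w envelope beta g (X0 w).
  rewrite [LHS]integralE [RHS]integralE; congr (_ - _).
  - rewrite (has_law_integral mX0 X0mu)//; last exact: measurable_funepos.
    by apply: eq_integral => w _; rewrite funepos.unlock.
  - rewrite (has_law_integral mX0 X0mu)//; last exact: measurable_funeneg.
    by apply: eq_integral => w _; rewrite funeneg.unlock.
have -> : \int[nu]_x (g x)%:E = \int[P]_w (G w)%:E.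
  have F0T : F0 setT by rewrite -(sub_sigma_algebraE sF0); exact: measurableT.
  rewrite (integral_cond_law sF0 mX1 kX1 mg igX1)// [LHS]integralE [RHS]integralE.
  have mg' : measurable_fun setT (fun y : R => (g y)%:E) by exact/measurable_EFinP.
  congr (_ - _).
  - rewrite (has_law_integral mX1 X1nu)//; last exact: measurable_funepos.
    by apply: eq_integral => w _; rewrite funepos.unlock.
  - rewrite (has_law_integral mX1 X1nu)//; last exact: measurable_funeneg.
    by apply: eq_integral => w _; rewrite funeneg.unlock.
apply: integral_le_ae => //.
- exact: measurableT_comp.
- exact: measurable_int iG.
Qed.

End necessity.

(** * The superhedging functional *)

Section max_supp.
Local Open Scope ereal_scope.
Context {R : realType} (rho : probability R R).

(** Rational endpoints leave only countably many intervals, so that null sets can be united over all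
    points off the support. *)
Lemma notin_supp_itv y : ~ supp rho y ->
  exists p q : rat, `]ratr p, ratr q[%classic y /\ rho `]ratr p, ratr q[%classic = 0.
Proof.
move=> /existsNP[U /not_implyP[[oU Uy] /negP]]; rewrite -leNgt => rhoU.
have /nbhs_ballP[e /= e0 yeU] : nbhs y U by exact: open_nbhs_nbhs.
have [p] : exists p : rat, ratr p \in `](y - e)%R, y[ by apply: rat_in_itvoo; rewrite gtrBl.
rewrite in_itv/= => /andP[p1 p2].
have [q] : exists q : rat, ratr q \in `]y, (y + e)%R[ by apply: rat_in_itvoo; rewrite ltrDl.
rewrite in_itv/= => /andP[q1 q2].
exists p, q; split; first by rewrite /= in_itv/= p2 q1.
apply/eqP; rewrite eq_le measure_ge0 andbT; apply: le_trans rhoU.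
apply: le_measure; rewrite ?inE//; first exact: open_measurable.
move=> z /=; rewrite in_itv/= => /andP[z1 z2]; apply: yeU.
by rewrite /ball/= ltr_norml; apply/andP; split; lra.
Qed.

(** Positive mass makes [max_supp rho] nonempty, hence a single point [m]. Points above [m] are off
    the support, and countably many null rational intervals cover them. *)
Lemma biased_max beta : (0 < beta)%R -> biased beta rho ->
  exists m, beta%:E <= rho [set m] /\ rho `]m, +oo[%classic = 0.
Proof.
move=> b0 bb.
have [m [sm um]] : max_supp rho !=set0.
  apply/set0P; apply: contraPN bb => /eqP ms0; rewrite /biased ms0 measure0 lee_fin.
  by apply/negP; rewrite -ltNge.
have msE : max_supp rho = [set m].
  apply/seteqP; split => [z [sz uz]|_ ->//].
  by apply/eqP; rewrite eq_le um// uz.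
exists m; split; first by rewrite -msE.
pose N (n : nat) : set R := if unpickle n is Some (p, q) then
  if rho `]ratr (p : rat), ratr (q : rat)[%classic == 0 then `]ratr p, ratr q[%classic else set0
  else set0.
have N0 n : rho.-negligible (N n).
  rewrite /N; case: unpickle => [[p q]|]; last exact: negligible_set0.
  case: ifPn => [/eqP r0|_]; last exact: negligible_set0.
  by apply/negligibleP => //; exact: measurable_itv.
have : rho.-negligible `]m, +oo[%classic.
  apply: negligibleS (negligible_bigcup N0) => y /=; rewrite in_itv/= andbT => my.
  have [|p [q [ypq r0]]] := @notin_supp_itv y.
    by move=> sy; have := um _ sy; rewrite leNgt my.
  move: (pickle (p, q)) (pickleK (p, q)) => n nK; exists n; first exact: I.
  by rewrite /N nK r0 eqxx.
by move/negligibleP => ->.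
Qed.

End max_supp.

(* Test functions [F ((x, m), (y, e))]: [x] and [y] stand for the two values of
   the martingale, [m] for the maximum of the support of the conditional law of
   [y], and [e] for the indicator of a part of [y = m] of conditional
   probability [beta]. *)
Section dual_functional.
Context {R : realType}.
Variables (mu nu : probability R R) (beta : R).
Hypotheses (mu1 : finite_first_moment mu) (nu1 : finite_first_moment nu).
Hypothesis beta_ge0 : 0 <= beta.
Hypothesis munu : biased_le beta mu nu.

(** At [beta = 0] the variable [e] gives no hold on [m], which could escape to infinity; both are
    fixed at 0 instead. *)
Definition admissible (m y e : R) := if 0 < beta then
  [/\ y <= m, 0 <= e <= 1 & e * (m - y) = 0] else m = 0 /\ e = 0.

Definition weight (p : R * R * (R * R)) : R :=
  1 + `|p.1.1| + `|p.1.2| + `|p.2.1| + `|p.2.2|.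

Definition linear_growth (F : R * R * (R * R) -> R^o) :=
  exists C, forall p, `|F p| <= C * weight p.

(** The multipliers need neither measurability nor growth bounds: whenever this inequality is
    integrated against a competitor, [x] and [m] are fixed. *)
Definition superhedges (F : R * R * (R * R) -> R) (a g : R -> R) :=
  exists s t : R -> R -> R, forall x m y e, admissible m y e ->
    F ((x, m), (y, e)) + s x m * (y - x) + t x m * (e - beta) <= a x + g y.

Let adm (a : R -> R) := continuous a /\ linearly_bounded a.

Let prices F := [set c | exists a g, [/\ adm a, adm g, superhedges F a g
  & c = (\int[mu]_x a x + \int[nu]_y g y)%R]].

Let adm_integrable (rho : probability R R) a : finite_first_moment rho -> adm a ->
  rho.-integrable setT (EFin \o a).
Proof. by move=> ? [? ?]; exact: linearly_bounded_integrable. Qed.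

Let admD a g : adm a -> adm g -> adm (fun x => a x + g x).
Proof.
move=> [ca [C C0 aC]] [cg [D D0 gD]]; split.
  by move=> x; apply: cvgD; [exact: ca|exact: cg].
exists (C + D); first exact: addr_gt0.
by move=> x; rewrite (le_trans (ler_normD _ _))// mulrDl lerD.
Qed.

Let admZ (c : R) a : adm a -> adm (fun x => c * a x).
Proof.
move=> [ca [C C0 aC]]; split.
  by move=> x; apply: cvgM; [exact: cvg_cst|exact: ca].
exists ((`|c| + 1) * C); first by rewrite mulr_gt0// ltr_wpDl.
move=> x; rewrite normrM -mulrA; apply: ler_pM => //; by rewrite lerDl.
Qed.

Let admN a : adm a -> adm (fun x => - a x).
Proof.
move=> /(admZ (-1)); rewrite (_ : (fun _ => _) = (fun x => - a x))//.
by apply/funext => x; rewrite mulN1r.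
Qed.

Let adm_cst c : adm (cst c).
Proof.
split; first by move=> x; exact: cvg_cst.
exists (`|c| + 1); first by rewrite ltr_wpDl.
move=> x; rewrite /cst; have := normr_ge0 x; have := normr_ge0 c; nra.
Qed.

Let adm_norm : adm (fun x => `|x|).
Proof.
split; first by move=> x; exact: norm_continuous.
by exists 1 => // x; rewrite mul1r normr_id lerDr.
Qed.

Let pricesD F G c d : prices F c -> prices G d ->
  prices (fun p => F p + G p) (c + d).
Proof.
move=> [a [g [Aa Ag [s [t st]] ->]]] [a' [g' [Aa' Ag' [s' [t' st']] ->]]].
exists (fun x => a x + a' x), (fun x => g x + g' x); split; [exact: admD|exact: admD| |].
- exists (fun x m => s x m + s' x m), (fun x m => t x m + t' x m) => x m y e Dp.
  by have := st x m y e Dp; have := st' x m y e Dp; lra.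
- rewrite !RintegralD//; first by rewrite addrACA.
  all: exact: adm_integrable.
Qed.

Let pricesZ F c k : 0 <= k -> prices F c -> prices (fun p => k * F p) (k * c).
Proof.
move=> k0 [a [g [Aa Ag [s [t st]] ->]]].
exists (fun x => k * a x), (fun x => k * g x); split; [exact: admZ|exact: admZ| |].
- exists (fun x m => k * s x m), (fun x m => k * t x m) => x m y e Dp.
  rewrite -!mulrA -!mulrDr; apply: ler_wpM2l => //.
  exact: st.
- rewrite !RintegralZl//; first by rewrite mulrDr.
  all: exact: adm_integrable.
Qed.

(* Integrate the superhedging inequality against [rho] with mean [x] and
   maximum [m], giving [e = 1] conditional probability [beta / rho [set m]] on
   the atom [m]: the multipliers disappear. *)
Let prices0_envelope a g x : adm a -> adm g -> superhedges (fun=> 0) a g ->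
  ((- a x)%:E <= envelope beta g x)%E.
Proof.
move=> Aa Ag [s [t st]]; apply: le_ereal_inf_tmp => _ [rho [rho1 mx bb] <-].
have ig := adm_integrable rho1 Ag.
have iid : rho.-integrable setT (EFin \o (fun y : R => y)) := rho1.
have [m [r [r0 br hm]]] : exists m r, [/\ r = fine (rho [set m]), beta <= r &
    {ae rho, forall y,
      0 <= a x + g y - s x m * (y - x) + t x m * (beta - beta / r * \1_[set m] y)}].
  have [b0|nb0] := ltP 0 beta.
    have [m [bm mm]] := biased_max b0 bb.
    have rE : (rho [set m] = (fine (rho [set m]))%:E)%E by rewrite fineK// fin_num_measure.
    exists m, (fine (rho [set m])); split => //; first by rewrite -lee_fin -rE.
    move: bm; rewrite rE lee_fin; move: (fine _) => r br.
    exists `]m, +oo[%classic; split => // y /=; apply: contra_notP.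
    move=> /negP; rewrite in_itv/= andbT -leNgt => ym.
    have r0 : 0 < r by exact: lt_le_trans br.
    have A0 : admissible m y 0.
      by rewrite /admissible b0; split; rewrite ?lexx ?ler01 ?mul0r.
    have A1 : admissible m m 1.
      by rewrite /admissible b0; split; rewrite ?lexx ?ler01 ?subrr ?mulr0.
    (* Off the atom the case [e = 0] is enough. At [y = m] the claim is the convex combination of
       the cases [e = 0] and [e = 1] with weights [1 - beta / r] and [beta / r]. *)
    have h0 := st x m y 0 A0; have h1 := st x m m 1 A1.
    rewrite indicE; case: (boolP (y \in [set m])) => [/set_mem/= yE|_]; last first.
      by rewrite mulr0; lra.
    rewrite mulr1; have br0 : 0 <= beta / r by rewrite divr_ge0// ltW.
    have br1 : beta / r <= 1 by rewrite ler_pdivrMr// mul1r.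
    move: h0 h1; rewrite yE; move: (beta / r) (a x) (g m) (s x m) (t x m) br0 br1 => q *.
    nra.
  have b0 : beta = 0 by apply/eqP; rewrite eq_le beta_ge0 andbT.
  exists 0, (fine (rho [set 0])); split => //; first by rewrite b0 fine_ge0.
  apply: aeW => y; rewrite b0 !mul0r subrr mulr0 addr0.
  have A0 : admissible 0 y 0 by rewrite /admissible b0 ltxx.
  by have := st x 0 y 0 A0; rewrite b0; lra.
have ind : rho.-integrable setT (EFin \o (\1_[set m] : R -> R)).
  exact: integrable_indic.
have mean : \int[rho]_y y = x by rewrite /Rintegral mx.
have ia : rho.-integrable setT (EFin \o (fun=> a x + s x m * x + t x m * beta)).
  exact: finite_measure_integrable_cst.
have is' : rho.-integrable setT (EFin \o (fun y : R => s x m * y)).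
  by have := integrableZl measurableT (s x m) iid; apply: eq_integrable.
have it : rho.-integrable setT (EFin \o (fun y : R => t x m * beta / r * \1_[set m] y)).
  by have := integrableZl measurableT (t x m * beta / r) ind; apply: eq_integrable.
pose H y := a x + s x m * x + t x m * beta + g y - s x m * y - t x m * beta / r * \1_[set m] y.
have Ic (c : R) : \int[rho]_y c = c.
  rewrite Rintegral_cst//; transitivity (c * fine 1%E); last by rewrite mulr1.
  by congr (_ * fine _); exact: probability_setT.
have HE : \int[rho]_y H y = a x + \int[rho]_y g y.
  have i1 : rho.-integrable setT (EFin \o (fun y => a x + s x m * x + t x m * beta + g y)).
    by have := integrableD measurableT ia ig; apply: eq_integrable.
  have i2 : rho.-integrable setT (EFin \o (fun y =>
      a x + s x m * x + t x m * beta + g y - s x m * y)).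
    by have := integrableB measurableT i1 is'; apply: eq_integrable.
  rewrite /H RintegralB// RintegralB// RintegralD// RintegralZl// RintegralZl//.
  rewrite mean Ic.
  have -> : \int[rho]_y \1_[set m] y = r.
    by rewrite /Rintegral integral_indic// setIT r0.
  have [b0|nb0] := ltP 0 beta.
    by rewrite mulfVK; [ring|rewrite gt_eqF// (lt_le_trans b0)].
  have -> : beta = 0 by apply/eqP; rewrite eq_le nb0.
  by rewrite mulr0 !mul0r; ring.
have H0 : 0 <= \int[rho]_y H y.
  rewrite /Rintegral fine_ge0// -(integral0 rho setT); apply: integral_le_ae => //.
    apply/measurable_EFinP; rewrite /H.
    apply: measurable_funB; last by apply: measurable_funM => //; exact: measurable_indic.
    apply: measurable_funB; last exact: measurable_funM.
    by apply: measurable_funD => //; apply: continuous_measurable; exact: Ag.1.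
  apply: filterS hm => y; rewrite lee_fin.
  by congr (_ <= _); rewrite /H; ring.
rewrite (_ : (\int[rho]_y (g y)%:E = (\int[rho]_y g y)%:E)%E); last first.
  by rewrite /Rintegral fineK//; exact: integrable_fin_num.
by rewrite lee_fin -subr_ge0 opprK addrC -HE.
Qed.

(** Here [munu] enters: [-a] lies below the envelope of [g], whose integral under [mu] is at most
    that of [g] under [nu]. This is the nondegeneracy of the cost. *)
Let prices0_ge0 c : prices (fun=> 0) c -> 0 <= c.
Proof.
move=> [a [g [Aa Ag ag ->]]].
have ag_env x := prices0_envelope x Aa Ag ag.
have ia := adm_integrable mu1 Aa; have ig := adm_integrable nu1 Ag.
have ma : measurable_fun setT (fun x => (- a x)%:E).
  apply/measurable_EFinP; apply: continuous_measurable.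
  by have [ca _] := admN Aa; exact: ca.
have : (\int[mu]_x (- a x)%:E <= \int[nu]_y (g y)%:E)%E.
  apply: (le_trans _ (munu Ag.1 Ag.2)); apply: integral_le_ae => //.
    by apply: measurable_envelope; [exact: Ag.1|exact: Ag.2].
  exact: aeW.
have -> : (\int[mu]_x (- a x)%:E = (- \int[mu]_x a x)%:E)%E.
  rewrite /Rintegral EFinN fineK; last exact: integrable_fin_num.
  by rewrite -integralN//; exact: integrable_add_def.
have -> : (\int[nu]_y (g y)%:E = (\int[nu]_y g y)%:E)%E.
  by rewrite /Rintegral fineK//; exact: integrable_fin_num.
by rewrite lee_fin -subr_ge0 opprK addrC.
Qed.

(** The terms [1 + |e| <= 2], [|x|] and [|y|] of the weight are paid directly. The multiplier
    [D |m| / beta] of [e - beta] removes [D |m|] and adds [D e |m| / beta], at most [D |y| / beta]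
    because [e m = e y]. At [beta = 0] the convention [1 / 0 = 0] fits, as [m] and [e] vanish. *)
Let prices_ex F : linear_growth F -> prices F !=set0.
Proof.
move=> [C FC]; pose D := `|C|.
pose a (x : R) := D * (2 + `|x|); pose g (y : R) := (D + D / beta) * `|y|.
exists (\int[mu]_x a x + \int[nu]_y g y), a, g; split => //.
- by apply: admZ; apply: (admD (adm_cst 2)); exact: adm_norm.
- by apply: admZ; exact: adm_norm.
exists (fun _ _ => 0), (fun x m => D / beta * `|m|) => x m y e.
have D0 : 0 <= D by exact: normr_ge0.
have : F ((x, m), (y, e)) <= D * weight ((x, m), (y, e)).
  apply: (le_trans (ler_norm _)); apply: (le_trans (FC _)).
  by rewrite ler_wpM2r ?ler_norm// /weight !addr_ge0.
rewrite /weight/= /admissible /a /g.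
have Db0 : 0 <= D / beta by rewrite mulr_ge0// invr_ge0.
case: ifPn => [b0 FD [ym /andP[e0 e1] eym]|nb0 FD [m0 e0]].
  have Dbb : D / beta * beta = D by rewrite mulfVK// gt_eqF.
  have eE : e * `|m| <= `|y|.
    rewrite -(ger0_norm e0) -normrM.
    have -> : e * m = e * y by apply/eqP; rewrite -subr_eq0 -mulrBr eym.
    by rewrite normrM ler_piMl// ger0_norm.
  have := ler_wpM2l Db0 eE.
  have De : D * `|e| <= D by rewrite (ger0_norm e0) ler_piMr.
  move: FD Dbb De; rewrite (ger0_norm e0).
  move: (F _) (D / beta) (`|x|) (`|m|) (`|y|) => f d u v w FD Dbb De dE.
  have -> : d * v * (e - beta) = d * (e * v) - D * v by rewrite -Dbb; ring.
  lra.
have b0 : beta = 0 by apply/eqP; rewrite eq_le beta_ge0 andbT leNgt.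
by move: FD; rewrite m0 e0 b0 invr0 normr0 !(mulr0, mul0r, addr0, subr0); lra.
Qed.

Let Q F := inf (prices F).

(** A price of [F] and a price of [-F] add up to a price of 0, which is nonnegative; any price of
    [-F] thus bounds those of [F] from below. *)
Let prices_lbound F : linear_growth F -> exists c, lbound (prices F) c.
Proof.
move=> [C FC]; have [c Fc] : prices (fun p => (-1) * F p) !=set0.
  by apply: prices_ex; exists C => p; rewrite mulN1r normrN.
exists (- c) => d Fd; rewrite -subr_ge0 opprK; apply: prices0_ge0.
rewrite (_ : (fun=> 0) = (fun p => F p + (-1) * F p)); first exact: pricesD.
by apply/funext => p; rewrite mulN1r subrr.
Qed.

Let Q_le F c : linear_growth F -> prices F c -> Q F <= c.
Proof. by move=> LF Fc; apply: ge_inf => //; exact: prices_lbound. Qed.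

Let Q_ge F c : linear_growth F -> lbound (prices F) c -> c <= Q F.
Proof. by move=> LF Fc; apply: lb_le_inf => //; exact: prices_ex. Qed.

Let linear_growthD F G : linear_growth F -> linear_growth G -> linear_growth (F + G).
Proof.
move=> [C FC] [D GD]; exists (C + D) => p; rewrite mulrDl.
by rewrite (le_trans (ler_normD _ _))// lerD.
Qed.

Let linear_growthZ (c : R) F : linear_growth F -> linear_growth (c *: F).
Proof.
move=> [C FC]; exists (`|c| * C) => p.
by rewrite -mulrA [leLHS]normrM ler_wpM2l.
Qed.

Let linear_growth0 : linear_growth 0.
Proof. by exists 0 => p; rewrite mul0r [leLHS]normr0. Qed.

Let Q_sublinear : sublinear_on linear_growth Q.
Proof.
split.
- move=> F G LF LG; have LFG := linear_growthD LF LG.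
  rewrite -lerBlDr; apply: Q_ge => // c Fc.
  rewrite lerBlDr -lerBlDl; apply: Q_ge => // d Gd.
  by rewrite lerBlDl; apply: Q_le => //; exact: pricesD.
- move=> k F k0 LF; rewrite -ler_pdivrMl//; apply: Q_ge => // c Fc.
  rewrite ler_pdivrMl//; apply: Q_le; first exact: linear_growthZ.
  by apply: pricesZ => //; exact: ltW.
Qed.

Theorem dual_functional : exists L : (R * R * (R * R) -> R^o) -> R,
  [/\ linear_on linear_growth L &
   forall F a g, linear_growth F -> continuous a -> linearly_bounded a ->
     continuous g -> linearly_bounded g -> superhedges F a g ->
     L F <= (\int[mu]_x a x + \int[nu]_y g y)%R].
Proof.
have [L linL LQ] := hahn_banach linear_growthD linear_growthZ linear_growth0 Q_sublinear.
exists L; split => // F a g LF ca la cg lg Fag.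
by apply: (le_trans (LQ _ LF)); apply: Q_le => //; exists a, g; split.
Qed.

End dual_functional.

(** * A probability space for the superhedging functional *)

Section pointwise_continuity.
Context {T : topologicalType} {R : realType}.
Implicit Types f g : T -> R.

Lemma continuous_add f g : continuous f -> continuous g -> continuous (fun x => f x + g x).
Proof. by move=> cf cg x; apply: cvgD; [exact: cf|exact: cg]. Qed.

Lemma continuous_sub f g : continuous f -> continuous g -> continuous (fun x => f x - g x).
Proof. by move=> cf cg x; apply: cvgB; [exact: cf|exact: cg]. Qed.

Lemma continuous_mul f g : continuous f -> continuous g -> continuous (fun x => f x * g x).
Proof. by move=> cf cg x; apply: cvgM; [exact: cf|exact: cg]. Qed.

Lemma continuous_minr f g : continuous f -> continuous g ->
  continuous (fun x => Num.min (f x) (g x)).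
Proof. by move=> cf cg x; apply: (@continuous_min _ _ f g); [exact: cf|exact: cg]. Qed.

Lemma continuous_maxr f g : continuous f -> continuous g ->
  continuous (fun x => Num.max (f x) (g x)).
Proof. by move=> cf cg x; apply: (@continuous_max _ _ f g); [exact: cf|exact: cg]. Qed.

Lemma continuous_normr f : continuous f -> continuous (fun x => `|f x|).
Proof. by move=> cf x; apply: cvg_norm; exact: cf. Qed.

Lemma continuous_cst (c : R) : continuous (fun _ : T => c).
Proof. by move=> x; exact: cvg_cst. Qed.

(** The sets where [f n < e] are open, increase with [n] and cover [K]. *)
Lemma dini (K : set T) (f : nat -> T -> R) (e : R) : compact K -> 0 < e ->
  (forall n, continuous (f n)) -> (forall m n x, (m <= n)%N -> f n x <= f m x) ->
  (forall x, f n x @[n --> \oo] --> (0 : R)) ->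
  exists n, forall x, K x -> f n x < e.
Proof.
move=> /compact_near_coveringP cK e0 cf f_ni f0.
have := cK nat \oo (fun n x => f n x < e) _ _.
case=> [x _|n _ /(_ n (leqnn n)) h]; last by exists n.
have /cvgr_lt/(_ e e0) [n _ /(_ n (leqnn n)) fn] := f0 x.
have /cvgr_lt/(_ e fn) fnx := cf n x.
exists ([set y | f n y < e], [set m | (n <= m)%N]) => /=.
  by split => //; exists n.
by move=> [y m] [/= fny nm]; exact: le_lt_trans (f_ni _ _ _ nm) fny.
Qed.

End pointwise_continuity.

Section martingale_space.
Context {R : realType}.
Variables (mu nu : probability R R) (beta : R).
Hypotheses (mu1 : finite_first_moment mu) (nu1 : finite_first_moment nu).
Hypotheses (beta_ge0 : 0 <= beta).
Variable L : (R * R * (R * R) -> R^o) -> R.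
Hypothesis linL : linear_on linear_growth L.
Hypothesis L_le : forall F a g, linear_growth F ->
  continuous a -> linearly_bounded a -> continuous g -> linearly_bounded g ->
  superhedges beta F a g -> L F <= (\int[mu]_x a x + \int[nu]_y g y)%R.

Local Notation T := (R * R * (R * R))%type.

Let weight_ge1 (p : T) : 1 <= weight p.
Proof. by rewrite /weight -!addrA lerDl !addr_ge0. Qed.

Let lgD (F G : T -> R) : linear_growth F -> linear_growth G ->
  linear_growth (fun p => F p + G p).
Proof.
move=> [C FC] [D GD]; exists (C + D) => p; rewrite mulrDl.
by rewrite (le_trans (ler_normD _ _))// lerD.
Qed.

Let lgZ (c : R) (F : T -> R) : linear_growth F -> linear_growth (fun p => c * F p).
Proof.
move=> [C FC]; exists (`|c| * C) => p.
by rewrite -mulrA normrM ler_wpM2l.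
Qed.

Let lg_le (F G : T -> R) : linear_growth G -> (forall p, `|F p| <= `|G p|) ->
  linear_growth F.
Proof. by move=> [C GC] FG; exists C => p; exact: le_trans (FG p) (GC p). Qed.

Let lg_max (F G : T -> R) : linear_growth F -> linear_growth G ->
  linear_growth (fun p => Num.max (F p) (G p)).
Proof.
move=> [C FC] [D GD]; exists (C + D) => p; rewrite mulrDl.
have := FC p; have := GD p.
have : 0 <= `|F p| by []. have : 0 <= `|G p| by [].
by rewrite /Num.max; case: ifPn => _; lra.
Qed.

Let lg_min (F G : T -> R) : linear_growth F -> linear_growth G ->
  linear_growth (fun p => Num.min (F p) (G p)).
Proof.
move=> [C FC] [D GD]; exists (C + D) => p; rewrite mulrDl.
have := FC p; have := GD p.
have : 0 <= `|F p| by []. have : 0 <= `|G p| by [].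
by rewrite /Num.min; case: ifPn => _; lra.
Qed.

Let lg_cst (c : R) : linear_growth (fun _ : T => c).
Proof. by exists `|c| => p; rewrite ler_peMr. Qed.

Let lg_weight : linear_growth (fun p : T => weight p).
Proof. by exists 1 => p; rewrite mul1r ger0_norm// (le_trans ler01). Qed.

Let le_weight (p : T) : [/\ `|p.1.1| <= weight p, `|p.1.2| <= weight p,
  `|p.2.1| <= weight p & `|p.2.2| <= weight p].
Proof.
rewrite /weight.
have h1 := normr_ge0 p.1.1; have h2 := normr_ge0 p.1.2.
have h3 := normr_ge0 p.2.1; have h4 := normr_ge0 p.2.2.
by split; lra.
Qed.

Let lg_x : linear_growth (fun p : T => p.1.1).
Proof. by exists 1 => p; rewrite mul1r; have [] := le_weight p. Qed.
Let lg_m : linear_growth (fun p : T => p.1.2).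
Proof. by exists 1 => p; rewrite mul1r; have [] := le_weight p. Qed.
Let lg_y : linear_growth (fun p : T => p.2.1).
Proof. by exists 1 => p; rewrite mul1r; have [] := le_weight p. Qed.
Let lg_e : linear_growth (fun p : T => p.2.2).
Proof. by exists 1 => p; rewrite mul1r; have [] := le_weight p. Qed.

Let c_x : continuous (fun p : T => p.1.1).
Proof. by move=> p; apply: (@continuous_comp _ _ _ fst fst); exact: cvg_fst. Qed.
Let c_m : continuous (fun p : T => p.1.2).
Proof. by move=> p; apply: (@continuous_comp _ _ _ fst snd); [exact: cvg_fst|exact: cvg_snd]. Qed.
Let c_y : continuous (fun p : T => p.2.1).
Proof. by move=> p; apply: (@continuous_comp _ _ _ snd fst); [exact: cvg_snd|exact: cvg_fst]. Qed.
Let c_e : continuous (fun p : T => p.2.2).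
Proof. by move=> p; apply: (@continuous_comp _ _ _ snd snd); exact: cvg_snd. Qed.

Let adm (a : R -> R) := continuous a /\ linearly_bounded a.

Let lg_adm a : adm a ->
  linear_growth (fun p : T => a p.1.1) /\ linear_growth (fun p : T => a p.2.1).
Proof.
move=> [_ [C C0 aC]]; split; exists C => p; apply: (le_trans (aC _)); rewrite ler_pM2l//.
  rewrite /weight; have := normr_ge0 p.1.2; have := normr_ge0 p.2.1; have := normr_ge0 p.2.2; lra.
rewrite /weight; have := normr_ge0 p.1.2; have := normr_ge0 p.1.1; have := normr_ge0 p.2.2; lra.
Qed.

Let LD (F G : T -> R) : linear_growth F -> linear_growth G ->
  L (fun p => F p + G p) = L F + L G.
Proof. exact: linL.1. Qed.

Let LZ (c : R) (F : T -> R) : linear_growth F -> L (fun p => c * F p) = c * L F.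
Proof. exact: linL.2. Qed.

Let LN (F : T -> R) : linear_growth F -> L (fun p => - F p) = - L F.
Proof.
move=> LF; rewrite -mulN1r -LZ//; congr L; apply/funext => p; by rewrite mulN1r.
Qed.

Let lgN (F : T -> R) : linear_growth F -> linear_growth (fun p => - F p).
Proof. by move=> LF; apply: (lg_le LF) => p; rewrite normrN. Qed.

Let adm0 : adm (fun=> 0).
Proof.
split; first exact: continuous_cst.
by exists 1 => // x; rewrite normr0 mul1r addr_ge0.
Qed.

Let I0 (rho : probability R R) : \int[rho]_x 0 = 0.
Proof. by rewrite /Rintegral integral0. Qed.

(** Superhedging is tested at admissible points only, so [L] ignores the values of [F] elsewhere;
    this will confine the measure to those points. *)
Let L_le0 (F : T -> R) : linear_growth F ->
  (forall x m y e, admissible beta m y e -> F ((x, m), (y, e)) <= 0) -> L F <= 0.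
Proof.
move=> LF F0; have [c0 l0] := adm0.
have := L_le LF c0 l0 c0 l0; rewrite !I0 addr0; apply.
exists (fun _ _ => 0), (fun _ _ => 0) => x m y e Dp.
by rewrite !mul0r !addr0; exact: F0.
Qed.

Let L_ge0 (F : T -> R) : linear_growth F ->
  (forall x m y e, admissible beta m y e -> 0 <= F ((x, m), (y, e))) -> 0 <= L F.
Proof.
move=> LF F0; rewrite -oppr_le0 -LN//; apply: L_le0; first exact: lgN.
by move=> *; rewrite oppr_le0; exact: F0.
Qed.

Let L_eq0 (F : T -> R) : linear_growth F ->
  (forall x m y e, admissible beta m y e -> F ((x, m), (y, e)) = 0) -> L F = 0.
Proof.
move=> LF F0; apply/eqP; rewrite eq_le L_le0//= ?L_ge0//.
  by move=> *; rewrite F0.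
by move=> *; rewrite F0.
Qed.

Let L_mono (F G : T -> R) : linear_growth F -> linear_growth G ->
  (forall p, F p <= G p) -> L F <= L G.
Proof.
move=> LF LG FG; rewrite -subr_le0 -LN// -LD//; last exact: lgN.
apply: L_le0; first exact: (lgD LF (lgN LG)).
by move=> *; rewrite subr_le0.
Qed.

Let admN a : adm a -> adm (fun x => - a x).
Proof.
move=> [ca [C C0 aC]]; split; first by move=> x; apply: cvgN; exact: ca.
by exists C => // x; rewrite normrN.
Qed.

Let adm_integrable (rho : probability R R) a : finite_first_moment rho -> adm a ->
  rho.-integrable setT (EFin \o a).
Proof. by move=> ? [? ?]; exact: linearly_bounded_integrable. Qed.

Let RintegralN (rho : probability R R) a : finite_first_moment rho -> adm a ->
  \int[rho]_x (- a x) = - \int[rho]_x a x.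
Proof.
move=> rho1 Aa; rewrite -mulN1r -RintegralZl//; last exact: adm_integrable.
by congr Rintegral; apply/funext => x; rewrite mulN1r.
Qed.

(** A function of [x] superhedges itself at the price of its integral; the same bound for [-a] turns
    the inequality into an equality. *)
Let L_x a : adm a -> L (fun p => a p.1.1) = \int[mu]_x a x.
Proof.
have le b : adm b -> L (fun p => b p.1.1) <= \int[mu]_x b x.
  move=> [cb lb]; have [c0 l0] := adm0.
  have := L_le (lg_adm (conj cb lb)).1 cb lb c0 l0; rewrite I0 addr0; apply.
  by exists (fun _ _ => 0), (fun _ _ => 0) => x m y e Dp; rewrite !mul0r !addr0.
move=> Aa; apply/eqP; rewrite eq_le le//= -lerN2 -RintegralN// -LN.
  exact: (le _ (admN Aa)).
exact: (lg_adm Aa).1.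
Qed.

Let L_y a : adm a -> L (fun p => a p.2.1) = \int[nu]_x a x.
Proof.
have le b : adm b -> L (fun p => b p.2.1) <= \int[nu]_x b x.
  move=> [cb lb]; have [c0 l0] := adm0.
  have := L_le (lg_adm (conj cb lb)).2 c0 l0 cb lb; rewrite I0 add0r; apply.
  by exists (fun _ _ => 0), (fun _ _ => 0) => x m y e Dp; rewrite !mul0r !addr0 add0r.
move=> Aa; apply/eqP; rewrite eq_le le//= -lerN2 -RintegralN// -LN.
  exact: (le _ (admN Aa)).
exact: (lg_adm Aa).2.
Qed.

Let lg_bounded_mul (phi : R -> R -> R) (F : T -> R) :
  (exists C, forall x m, `|phi x m| <= C) -> linear_growth F ->
  linear_growth (fun p => phi p.1.1 p.1.2 * F p).
Proof.
move=> [C phiC] [D FD]; exists (C * D) => p.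
by rewrite normrM -mulrA ler_pM.
Qed.

(** The multiplier [-phi] cancels the payoff identically, so the cost is at most 0, and likewise for
    the opposite payoff. [phi] is bounded so that the product keeps linear growth. *)
Let L_y_x (phi : R -> R -> R) : (exists C, forall x m, `|phi x m| <= C) ->
  L (fun p => phi p.1.1 p.1.2 * (p.2.1 - p.1.1)) = 0.
Proof.
have le psi : (exists C, forall x m, `|psi x m| <= C) ->
    L (fun p => psi p.1.1 p.1.2 * (p.2.1 - p.1.1)) <= 0.
  move=> bpsi; have [c0 l0] := adm0.
  have LF := lg_bounded_mul bpsi (lgD lg_y (lgN lg_x)).
  have := L_le LF c0 l0 c0 l0; rewrite !I0 addr0; apply.
  exists (fun x m => - psi x m), (fun _ _ => 0) => x m y e Dp /=.
  by rewrite mul0r !addr0 mulNr subrr.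
move=> bphi; apply/eqP; rewrite eq_le le//= -oppr_le0 -LN; last first.
  exact: lg_bounded_mul bphi (lgD lg_y (lgN lg_x)).
rewrite (_ : (fun p => _) = (fun p : T => - phi p.1.1 p.1.2 * (p.2.1 - p.1.1))).
  apply: (le (fun x m => - phi x m)).
  by have [C phiC] := bphi; exists C => x m; rewrite normrN.
by apply/funext => p; rewrite mulNr.
Qed.

Let L_e_beta (phi : R -> R -> R) : (exists C, forall x m, `|phi x m| <= C) ->
  L (fun p => phi p.1.1 p.1.2 * (p.2.2 - beta)) = 0.
Proof.
have le psi : (exists C, forall x m, `|psi x m| <= C) ->
    L (fun p => psi p.1.1 p.1.2 * (p.2.2 - beta)) <= 0.
  move=> bpsi; have [c0 l0] := adm0.
  have LF := lg_bounded_mul bpsi (lgD lg_e (lg_cst (- beta))).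
  have := L_le LF c0 l0 c0 l0; rewrite !I0 addr0; apply.
  exists (fun _ _ => 0), (fun x m => - psi x m) => x m y e Dp /=.
  by rewrite mul0r !addr0 mulNr subrr.
move=> bphi; apply/eqP; rewrite eq_le le//= -oppr_le0 -LN; last first.
  exact: lg_bounded_mul bphi (lgD lg_e (lg_cst (- beta))).
rewrite (_ : (fun p => _) = (fun p : T => - phi p.1.1 p.1.2 * (p.2.2 - beta))).
  apply: (le (fun x m => - phi x m)).
  by have [C phiC] := bphi; exists C => x m; rewrite normrN.
by apply/funext => p; rewrite mulNr.
Qed.

Let tail (n : nat) (y : R) := Num.max (`|y| - n%:R) 0.

Let adm_tail n : adm (tail n).
Proof.
split.
  apply: continuous_maxr; last exact: continuous_cst.
  apply: continuous_sub; last exact: continuous_cst.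
  by apply: continuous_normr => x; exact: cvg_id.
exists 1 => // y; rewrite mul1r ger0_norm; last by rewrite le_max lexx orbT.
have n0 : 0 <= n%:R :> R by []. have y0 := normr_ge0 y.
by rewrite ge_max; apply/andP; split; lra.
Qed.

Let tail_cvg (rho : probability R R) : finite_first_moment rho ->
  \int[rho]_y tail n y @[n --> \oo] --> (0 : R).
Proof.
move=> rho1; apply: fine_cvg; rewrite -[X in _ --> X](integral0 rho setT).
apply: (@dominated_cvg _ _ _ rho setT measurableT _ _ (fun y => `|y|%:E)) => //.
- move=> n; apply/measurable_EFinP; apply: continuous_measurable.
  by have [] := adm_tail n.
- move=> y _; apply: cvg_near_cst; near=> n; congr EFin; rewrite /tail max_r//.
  by rewrite subr_le0; near: n; exact: nbhs_infty_ger.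
- exact: (integrable_norm rho1).
- move=> n y _; rewrite lee_fin ger0_norm; last by rewrite /tail le_max lexx orbT.
  have n0 : 0 <= n%:R :> R by []. have y0 := normr_ge0 y.
  by rewrite /tail ge_max; apply/andP; split; lra.
Unshelve. all: by end_near. Qed.

(** The 2 absorbs [1 + |e|] at admissible points, and [3 n] the part of [|x|], [|m|] and [|y|] below
    level [n]. *)
Let weight_tail (n : nat) (p : T) := Num.max (weight p - (2 + 3 * n%:R)) 0.

Let lg_weight_tail n : linear_growth (weight_tail n).
Proof. exact: (lg_max (lgD lg_weight (lg_cst _)) (lg_cst 0)). Qed.

(** Tightness from the marginals alone. The factor [1 + beta^-1] counts the tail of [y] once for
    itself and [1 / beta] times in exchange for that of [m]. *)
Let L_weight_tail n : L (weight_tail n) <=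
  \int[mu]_x tail n x + (1 + beta^-1) * \int[nu]_y tail n y.
Proof.
have [ct lt] := adm_tail n.
rewrite -RintegralZl//; last exact: adm_integrable.
have [ct' lt'] : adm (fun y => (1 + beta^-1) * tail n y).
  split; first by apply: continuous_mul => //; exact: continuous_cst.
  have [C C0 tC] := lt; exists ((1 + beta^-1) * C).
    by rewrite mulr_gt0// ltr_pwDl// invr_ge0.
  move=> y; rewrite normrM ger0_norm; last by rewrite addr_ge0// invr_ge0.
  by rewrite -mulrA ler_wpM2l// addr_ge0// invr_ge0.
apply: L_le => //; exists (fun _ _ => 0), (fun _ m => tail n m / beta).
move=> x m y e; rewrite mul0r addr0 /admissible /weight_tail /weight/=.
have tail0 z : 0 <= tail n z by rewrite /tail le_max lexx orbT.
have tail_ge z : `|z| - n%:R <= tail n z by rewrite /tail le_max lexx.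
have hx := tail_ge x; have hm := tail_ge m; have hy := tail_ge y.
have tx := tail0 x; have tm := tail0 m; have ty := tail0 y.
case: ifPn => [b0 [ym /andP[e0 e1] eym]|nb0 [m0 e0]].
  (* [e] vanishes unless [y = m], so the multiplier [tail n m / beta] of
     [e - beta] trades the tail of [m] for that of [y]. *)
  have etail : e * tail n m = e * tail n y.
    have /eqP := eym; rewrite mulf_eq0 => /orP[/eqP ->|]; first by rewrite !mul0r.
    by rewrite subr_eq0 => /eqP ->.
  have -> : tail n m / beta * (e - beta) = e * tail n m / beta - tail n m.
    by field; rewrite gt_eqF.
  have -> : (1 + beta^-1) * tail n y = tail n y + tail n y / beta.
    by field; rewrite gt_eqF.
  rewrite etail (ger0_norm e0).
  have : e * tail n y / beta <= tail n y / beta.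
    by rewrite ler_pM2r ?invr_gt0// ler_piMl.
  have : 0 <= e * tail n y / beta by rewrite mulr_ge0 ?invr_ge0// mulr_ge0.
  move: (e * tail n y / beta) (tail n y / beta) => u v u0 uv.
  rewrite -lerBrDr ge_max; apply/andP; split; last lra.
  lra.
have b0 : beta = 0 by apply/eqP; rewrite eq_le beta_ge0 andbT leNgt.
rewrite m0 e0 b0 invr0 !mulr0 !mul0r !(normr0, addr0, subr0) mul1r.
have n0 : 0 <= n%:R :> R by [].
by rewrite ge_max; apply/andP; split; lra.
Qed.

Let L_weight_tail_cvg : L (weight_tail n) @[n --> \oo] --> (0 : R).
Proof.
apply: (@squeeze_cvgr _ _ _ _ (cst 0)
  (fun n => \int[mu]_x tail n x + (1 + beta^-1) * \int[nu]_y tail n y)).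
- near=> n; rewrite L_weight_tail andbT; apply: L_ge0 => // x m y e _.
  by rewrite /weight_tail le_max lexx orbT.
- exact: cvg_cst.
- rewrite -[X in _ --> X](addr0 (0 : R)); apply: cvgD; first exact: tail_cvg.
  rewrite -[X in _ --> X](mulr0 (1 + beta^-1)).
  by apply: cvgM; [exact: cvg_cst|exact: tail_cvg].
Unshelve. all: by end_near. Qed.

Let E (F : T -> R) := continuous F /\ linear_growth F.

(* Dini's theorem on a large box, and tightness outside of it. *)
Let L_daniell (f : nat -> T -> R) : (forall n, E (f n)) ->
  (forall n p, f n.+1 p <= f n p) -> (forall p, f n p @[n --> \oo] --> (0 : R)) ->
  L (f n) @[n --> \oo] --> (0 : R).
Proof.
move=> Ef f_ni f0.
have f_nI m n p : (m <= n)%N -> f n p <= f m p.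
  elim: n => [|n IH]; first by rewrite leqn0 => /eqP ->.
  rewrite leq_eqVlt => /predU1P[->//|mn]; exact: le_trans (f_ni n p) (IH mn).
have f_ge0 n p : 0 <= f n p.
  apply: (cvgr_to_le (f0 p)); near=> k; apply: f_nI.
  by near: k; exact: nbhs_infty_ge.
have [C fC] := (Ef 0%N).2.
have C0 : 0 <= C.
  have := fC ((0, 0), (0, 0)); rewrite /weight/= !normr0 !addr0 mulr1.
  exact: le_trans.
apply/cvgrPdist_le => e e0.
have e20 : 0 < e / 2 by rewrite divr_gt0.
have [k Lk] : exists k, 2 * C * L (weight_tail k) <= e / 2.
  have : 2 * C * L (weight_tail n) @[n --> \oo] --> 2 * C * (0 : R).
    by apply: cvgM; [exact: cvg_cst|exact: L_weight_tail_cvg].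
  rewrite mulr0 => /cvgr_le/(_ (e / 2) e20) [n _ /(_ n (leqnn n)) /= h].
  by exists n.
(* Twice the threshold of [weight_tail k]: where the weight is at least [M], in particular off the
   box, it is at most [2 * weight_tail k]. *)
pose M : R := 2 * (2 + 3 * k%:R).
pose I : set R := `[- M, M]%classic.
pose K : set T := (I `*` I) `*` (I `*` I).
have cI : compact I by exact: segment_compact.
have cK : compact K by do !apply: compact_setX.
have [n fn] := dini cK e20 (fun n => (Ef n).1) (fun m n x => @f_nI m n x) f0.
exists n => // j /= nj; rewrite sub0r normrN ger0_norm; last first.
  by apply: L_ge0 => //; exact: (Ef j).2.
apply: (@le_trans _ _ (L (fun p => e / 2 + (2 * C) * weight_tail k p))); last first.
  rewrite LD//; last exact: lgZ.
  rewrite LZ// (_ : L (fun=> e / 2) = e / 2); first by lra.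
  have Ac : adm (fun=> e / 2).
    split; first exact: continuous_cst.
    exists (e / 2) => // y; rewrite (gtr0_norm e20) ler_peMr ?lerDl//.
    exact: ltW.
  rewrite (L_x Ac) Rintegral_cst//; transitivity (e / 2 * fine 1%E); last by rewrite mulr1.
  by congr (_ * fine _); exact: probability_setT.
apply: L_mono; [exact: (Ef j).2|exact: lgD (lg_cst _) (lgZ _ (lg_weight_tail k))|].
move=> p; apply: (le_trans (f_nI n j p nj)).
have wt0 : 0 <= weight_tail k p by rewrite /weight_tail le_max lexx orbT.
have [Kp|nKp] := pselect (K p).
  apply: ltW; apply: (lt_le_trans (fn p Kp)); rewrite lerDl.
  by rewrite mulr_ge0// mulr_ge0.
have wM : M <= weight p.
  rewrite leNgt; apply/negP => wM; apply: nKp.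
  have [h1 h2 h3 h4] := le_weight p.
  by split; split; rewrite /I/= in_itv/= -ler_norml ltW//; apply: le_lt_trans wM.
apply: (@le_trans _ _ (C * weight p)).
  by apply: (le_trans (f_nI 0%N n p (leq0n n))); apply: (le_trans (ler_norm _)).
apply: (@le_trans _ _ (2 * C * weight_tail k p)); last by rewrite lerDr ltW.
rewrite -mulrA [leRHS]mulrCA ler_wpM2l//.
have : weight p - (2 + 3 * k%:R) <= weight_tail k p by rewrite /weight_tail le_max lexx.
by move: wM; rewrite /M; lra.
Unshelve. all: by end_near. Qed.

(** Nonnegative, continuous and of linear growth, with the admissible points as zero set. The
    product [e (m - y)] grows quadratically and is therefore cut at 1. *)
Let defect (p : T) : R :=
  if 0 < beta then
    Num.max (p.2.1 - p.1.2) 0 + Num.max (- p.2.2) 0 + Num.max (p.2.2 - 1) 0 +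
    Num.min 1 `|p.2.2 * (p.1.2 - p.2.1)|
  else `|p.1.2| + `|p.2.2|.

Let max_ge0 (a : R) : 0 <= Num.max a 0.
Proof. by rewrite le_max lexx orbT. Qed.

Let max_ge (a : R) : a <= Num.max a 0.
Proof. by rewrite le_max lexx. Qed.

Let min_ge0 (a : R) : 0 <= Num.min 1 `|a|.
Proof. by rewrite le_min ler01 normr_ge0. Qed.

Let defect_ge0 p : 0 <= defect p.
Proof. by rewrite /defect; case: ifPn => _; rewrite !addr_ge0. Qed.

Let defect_eq0 p : defect p = 0 <-> admissible beta p.1.2 p.2.1 p.2.2.
Proof.
rewrite /defect /admissible; case: ifPn => b0; split.
- have := max_ge0 (p.2.1 - p.1.2); have := max_ge (p.2.1 - p.1.2).
  have := max_ge0 (- p.2.2); have := max_ge (- p.2.2).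
  have := max_ge0 (p.2.2 - 1); have := max_ge (p.2.2 - 1).
  have := min_ge0 (p.2.2 * (p.1.2 - p.2.1)).
  move=> h1 h2 h3 h4 h5 h6 h7 h; split; [lra|apply/andP; split; lra|].
  have : Num.min 1 `|p.2.2 * (p.1.2 - p.2.1)| = 0 by lra.
  by rewrite /Num.min; case: ifPn => [_ /eqP|_ /eqP]; rewrite ?oner_eq0// normr_eq0 => /eqP.
- move=> [ym /andP[e0 e1] ->]; rewrite normr0 (min_r (@ler01 R)).
  by rewrite !max_r ?subr_le0 ?oppr_le0// !addr0.
- by move=> /eqP; rewrite paddr_eq0// !normr_eq0 => /andP[/eqP -> /eqP ->].
- by move=> [-> ->]; rewrite normr0 addr0.
Qed.

Let E_defect : E defect.
Proof.
rewrite /E /defect; case: (0 < beta); last first.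
  split; first by apply: continuous_add; exact: continuous_normr.
  have lgn F : linear_growth F -> linear_growth (fun p : T => `|F p|).
    by move=> lF; apply: (lg_le lF) => p; rewrite normr_id.
  by apply: lgD; exact: lgn.
have cc (c : R) := @continuous_cst T R c.
split.
  apply: continuous_add; first apply: continuous_add; first apply: continuous_add.
  - by apply: continuous_maxr => //; exact: continuous_sub.
  - apply: continuous_maxr => //; rewrite (_ : (fun x => - _) = fun x : T => 0 - x.2.2).
      exact: continuous_sub.
    by apply/funext => x; rewrite sub0r.
  - by apply: continuous_maxr => //; exact: continuous_sub.
  - apply: continuous_minr => //; apply: continuous_normr; apply: continuous_mul => //.
    exact: continuous_sub.
apply: lgD; first apply: lgD; first apply: lgD.
- exact: (lg_max (lgD lg_y (lgN lg_m)) (lg_cst 0)).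
- exact: (lg_max (lgN lg_e) (lg_cst 0)).
- exact: (lg_max (lgD lg_e (lg_cst (-1))) (lg_cst 0)).
- apply: (lg_le (lg_cst 1)) => p; rewrite (ger0_norm (min_ge0 _)) normr1.
  by rewrite ge_min lexx.
Qed.

Theorem martingale_space : exists (d : measure_display) (Omega : measurableType d)
    (P : probability Omega R) (X M Y e : Omega -> R),
  [/\ [/\ measurable_fun setT M, P.-integrable setT (EFin \o X),
          P.-integrable setT (EFin \o Y) & P.-integrable setT (EFin \o e)],
      forall a, continuous a -> linearly_bounded a ->
        (\int[P]_w (a (X w))%:E = \int[mu]_x (a x)%:E)%E /\
        (\int[P]_w (a (Y w))%:E = \int[nu]_x (a x)%:E)%E,
      forall phi : R -> R -> R, continuous (fun p : R * R => phi p.1 p.2) ->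
        (exists C, forall x m, `|phi x m| <= C) ->
        (\int[P]_w (phi (X w) (M w) * (Y w - X w))%:E = 0)%E /\
        (\int[P]_w (phi (X w) (M w) * (e w - beta))%:E = 0)%E &
      {ae P, forall w, admissible beta (M w) (Y w) (e w)}].
Proof.
have [] := @daniell R T E L.
- by split; [exact: continuous_cst|exact: lg_cst].
- by move=> f g [cf lf] [cg lg]; split; [exact: continuous_add|exact: lgD].
- by move=> c f [cf lf]; split; [apply: continuous_mul => //; exact: continuous_cst|exact: lgZ].
- by move=> f g [cf lf] [cg lg]; split; [exact: continuous_minr|exact: lg_min].
- have A1 : adm (fun=> 1).
    split; first exact: continuous_cst.
    by exists 1 => // y; rewrite normr1 mul1r lerDl.
  rewrite (_ : cst 1 = (fun p : T => (fun=> 1) p.1.1))// (L_x A1) Rintegral_cst// mul1r.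
  by transitivity (fine (1%E : \bar R)) => //; congr fine; exact: probability_setT.
- by move=> f g [cf lf] [cg lg]; exact: LD.
- by move=> c f [cf lf]; exact: LZ.
- by move=> f [cf lf] f0; apply: L_ge0.
- exact: L_daniell.
move=> d; case=> Omega; case=> P; case=> Z ZE; exists d, Omega, P.
exists (fun w => (Z w).1.1), (fun w => (Z w).1.2), (fun w => (Z w).2.1), (fun w => (Z w).2.2).
have [mX iX _] := ZE _ (conj c_x lg_x).
have [mM iM _] := ZE _ (conj c_m lg_m).
have [mY iY _] := ZE _ (conj c_y lg_y).
have [me ie _] := ZE _ (conj c_e lg_e).
have c_xm (phi : R -> R -> R) : continuous (fun p : R * R => phi p.1 p.2) ->
    continuous (fun p : T => phi p.1.1 p.1.2).
  move=> cphi p; apply: (@continuous_comp T (R * R)%type R fst (fun p : R * R => phi p.1 p.2)).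
    exact: cvg_fst.
  exact: cphi.
split => //.
- move=> a ca la; have Aa : adm a by [].
  have [lx ly] := lg_adm Aa; split.
  + have cax : continuous (fun p : T => a p.1.1).
      by move=> p; apply: (@continuous_comp T R R (fun p => p.1.1) a); [exact: c_x|exact: ca].
    have [_ _ ->] := ZE _ (conj cax lx).
    rewrite (L_x Aa) /Rintegral fineK//.
    exact: integrable_fin_num (adm_integrable mu1 Aa).
  + have cay : continuous (fun p : T => a p.2.1).
      by move=> p; apply: (@continuous_comp T R R (fun p => p.2.1) a); [exact: c_y|exact: ca].
    have [_ _ ->] := ZE _ (conj cay ly).
    rewrite (L_y Aa) /Rintegral fineK//.
    exact: integrable_fin_num (adm_integrable nu1 Aa).
- move=> phi cphi bphi; split.
  + have := ZE (fun p : T => phi p.1.1 p.1.2 * (p.2.1 - p.1.1)); case.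
      split; last exact: lg_bounded_mul bphi (lgD lg_y (lgN lg_x)).
      by apply: continuous_mul; [exact: c_xm|exact: continuous_sub].
    by move=> _ _ ->; rewrite L_y_x.
  + have := ZE (fun p : T => phi p.1.1 p.1.2 * (p.2.2 - beta)); case.
      split; last exact: lg_bounded_mul bphi (lgD lg_e (lg_cst (- beta))).
      by apply: continuous_mul; [exact: c_xm|apply: continuous_sub => //; exact: continuous_cst].
    by move=> _ _ ->; rewrite L_e_beta.
(* [L] vanishes on [defect], which is 0 at admissible points; a nonnegative function with zero
   integral is zero almost everywhere. *)
- have [mD iD ID] := ZE _ E_defect.
  have D0 : L defect = 0.
    apply: L_eq0; first exact: E_defect.2.
    by move=> x m y e' Dp; apply/defect_eq0.
  have : (\int[P]_w `|(defect (Z w))%:E| = 0)%E.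
    by under eq_integral do rewrite /= (ger0_norm (defect_ge0 _)); rewrite ID D0.
  have /(ae_eq_integral_abs P measurableT) h := (measurable_EFinP _ _).2 mD.
  move=> /h; apply: filterS => w /(_ I)[] /= Dw; exact/defect_eq0.
Qed.

End martingale_space.

(** * Sigma-algebras generated by rays *)

Section ramp.
Context {R : realType}.
Implicit Types (n : nat) (c x : R).

(** Bounded continuous functions tending to the indicator of the open ray above [c]: they transfer
    identities from continuous test functions to sets. *)
Definition ramp n c x : R := Num.min 1 (Num.max (n%:R * (x - c)) 0).

Lemma ramp_ge0 n c x : 0 <= ramp n c x.
Proof. by rewrite /ramp le_min ler01 le_max lexx orbT. Qed.

Lemma ramp_le1 n c x : ramp n c x <= 1.
Proof. by rewrite /ramp ge_min lexx. Qed.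

Lemma ramp_norm_le1 n c x : `|ramp n c x| <= 1.
Proof. by rewrite ger0_norm ?ramp_ge0// ramp_le1. Qed.

Lemma continuous_ramp n c : continuous (ramp n c).
Proof.
apply: continuous_minr; first exact: continuous_cst.
apply: continuous_maxr; last exact: continuous_cst.
apply: continuous_mul; first exact: continuous_cst.
apply: continuous_sub; last exact: continuous_cst.
by move=> x; exact: cvg_id.
Qed.

Lemma ramp_cvg c x : ramp n c x @[n --> \oo] --> ((c < x)%R%:R : R).
Proof.
apply: cvg_near_cst; have [cx|xc] := ltP c x; near=> n; rewrite /ramp/=.
  rewrite min_l// le_max; apply/orP; left.
  rewrite -ler_pdivrMr ?subr_gt0// mul1r.
  by near: n; exact: nbhs_infty_ger.
rewrite max_r ?mulr_ge0_le0 ?subr_le0//.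
by rewrite min_r.
Unshelve. all: by end_near. Qed.

End ramp.

Lemma integral_indic_cvg d (Omega : measurableType d) (R : realType)
    (P : probability Omega R) (f : Omega -> R) (A : set Omega) (g : nat -> Omega -> R) :
  measurable A -> P.-integrable setT (EFin \o f) ->
  (forall n, measurable_fun setT (g n)) -> (forall n w, `|g n w| <= 1) ->
  (forall w, g n w @[n --> \oo] --> (\1_A w : R)) ->
  (\int[P]_w (g n w * f w)%:E @[n --> \oo] --> \int[P]_(w in A) (f w)%:E)%E.
Proof.
move=> mA iF mg g1 gA.
have mf : measurable_fun setT f by apply/measurable_EFinP; case/integrableP: iF.
rewrite [X in _ --> X](_ : _ = \int[P]_w (\1_A w * f w)%:E)%E; last first.
  rewrite integral_mkcond; apply: eq_integral => w _.
  by rewrite patchE indicE; case: (w \in A); rewrite ?mul1r ?mul0r.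
apply: (@dominated_cvg _ _ _ P setT measurableT _ _ (fun w => `|f w|%:E)) => //.
- by move=> n; apply/measurable_EFinP; exact: measurable_funM.
- by move=> w _; apply: cvg_EFin; [exact: nearW|apply: cvgM; [exact: gA|exact: cvg_cst]].
- exact: (integrable_norm iF).
- by move=> n w _; rewrite lee_fin normrM ler_piMl.
Qed.

(** In the limit the ramps give the mass of the open upper rays, a generating family stable under
    intersection. *)
Lemma has_law_ramp d (Omega : measurableType d) (R : realType)
    (P : probability Omega R) (X : Omega -> R) (m : probability R R) :
  measurable_fun setT X ->
  (forall n c, (\int[P]_w (ramp n c (X w))%:E = \int[m]_x (ramp n c x)%:E)%E) ->
  has_law P X m.
Proof.
move=> mX PXm.
have mray c : measurable (`]c, +oo[%classic : set R) by [].
have i1 d' (T : measurableType d') (Q : probability T R) :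
    Q.-integrable setT (EFin \o fun=> 1) by exact: finite_measure_integrable_cst.
have ray_cvg d' (T : measurableType d') (Q : probability T R) (Z : T -> R) c :
    measurable_fun setT Z ->
    (\int[Q]_w (ramp n c (Z w))%:E @[n --> \oo] --> Q (Z @^-1` `]c, +oo[))%E.
  move=> mZ.
  have mA : measurable (Z @^-1` `]c, +oo[) by rewrite -[X in measurable X]setTI; exact: mZ.
  have := integral_indic_cvg (g := fun n w => ramp n c (Z w)) mA (i1 _ _ Q).
  rewrite integral_cst// mul1e => h.
  have {h} := h _ _ _; under [X in X @ _ --> _]funext => n do
    under eq_integral => w _ do rewrite mulr1.
  apply.
  - move=> n; apply: measurableT_comp => //; apply: continuous_measurable.
    exact: continuous_ramp.
  - by move=> n w; exact: ramp_norm_le1.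
  - move=> w; rewrite indicE (_ : (w \in _) = (c < Z w)); first exact: ramp_cvg.
    by apply/idP/idP; rewrite inE /= in_itv/= andbT.
have mid : measurable_fun setT (id : R -> R) by exact: measurable_id.
have bE : (measurable : set (set R)) = <<s measurable_realfun.RGenOInfty.G (R := R) >>.
  exact: measurable_realfun.RGenOInfty.measurableE.
move=> B mB; apply: (measure_unique (measurable_realfun.RGenOInfty.G (R := R))
  (fun n => `]- n%:R, +oo[%classic) bE) => //.
- move=> _ _ [a ->] [b ->]; exists (Num.max a b).
  by apply/seteqP; split => x /=; rewrite ?in_itv/= !andbT gt_max; [case=> -> ->|move/andP].
- by move=> n; exists (- n%:R).
- apply/seteqP; split => // x _; exists (Num.bound `|x|) => //=.
  rewrite in_itv/= andbT ltrNl.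
  by apply: le_lt_trans (archi_boundP (normr_ge0 x)); rewrite -normrN ler_norm.
- move=> _ [c ->]; have := ray_cvg _ _ P X c mX.
  under [X in X @ _ --> _]funext => n do rewrite PXm.
  move=> h; apply: (cvg_unique _ h); first by [].
  exact: (ray_cvg _ _ m id c mid).
- move=> n; apply: (@le_lt_trans _ _ 1%E); last by rewrite ltry.
  by apply: probability_le1; rewrite -[X in measurable X]setTI; exact: mX.
Qed.

Section ray_algebra.
Context {R : realType} d {Omega : measurableType d}.
Variables (X M : Omega -> R).
Hypotheses (mX : measurable_fun setT X) (mM : measurable_fun setT M).

(** Open quadrants in [(X, M)], a family stable under intersection that generates the sigma-algebra
    of the pair. A ray in one variable is recovered as a union over thresholds [-n] in the other. *)
Definition rays : set (set Omega) :=
  [set A | exists a b, A = [set w | a < X w /\ b < M w]].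

Lemma rays_measurable : rays `<=` measurable.
Proof.
move=> _ [a [b ->]]; rewrite (_ : [set _ | _] = X @^-1` `]a, +oo[ `&` M @^-1` `]b, +oo[).
  by apply: measurableI; rewrite -[X in measurable X]setTI; [exact: mX|exact: mM].
by apply/seteqP; split => w /=; rewrite !in_itv/= !andbT.
Qed.

Lemma raysI : setI_closed rays.
Proof.
move=> _ _ [a [b ->]] [a' [b' ->]]; exists (Num.max a a'), (Num.max b b').
apply/seteqP; split => w /=; rewrite !gt_max.
  by move=> [[-> ->] [-> ->]].
by move=> [/andP[-> ->] /andP[-> ->]].
Qed.

Lemma ray_sigma_algebra : Defs.sub_sigma_algebra <<s rays >>.
Proof.
split; first exact: smallest_sigma_algebra.
by apply: smallest_sub; [exact: sigma_algebra_measurable|exact: rays_measurable].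
Qed.

Lemma measurable_wrt_rays : measurable_wrt <<s rays >> X /\ measurable_wrt <<s rays >> M.
Proof.
have key (Z : Omega -> R) : (forall c, <<s rays >> [set w | c < Z w]) ->
    measurable_wrt <<s rays >> Z.
  move=> Zc.
  have bE : (measurable : set (set R)) = <<s measurable_realfun.RGenOInfty.G (R := R) >>.
    exact: measurable_realfun.RGenOInfty.measurableE.
  apply: (@measurability _ _ (g_sigma_algebraType <<s rays >>) R setT Z _ bE) => //.
  move=> _ [_ [c ->] <-]; rewrite setTI.
  rewrite [X in measurable X](_ : _ = [set w | c < Z w]).
    by rewrite sub_sigma_algebraE//; exact: ray_sigma_algebra.
  by apply/seteqP; split => w /=; rewrite in_itv/= andbT.
have exn (r : R) : exists n : nat, - n%:R < r.
  exists (Num.bound `|r|); rewrite ltrNl.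
  by apply: le_lt_trans (archi_boundP (normr_ge0 r)); rewrite -normrN ler_norm.
have sF := (smallest_sigma_algebra setT rays).
have bigU (B : nat -> set Omega) : (forall n, rays (B n)) -> <<s rays >> (\bigcup_n B n).
  by move=> rB; apply: sigma_algebra_bigcup => n; apply: sub_sigma_algebra; exact: rB.
split; apply: key => c.
- rewrite (_ : [set _ | _] = \bigcup_n [set w | c < X w /\ - n%:R < M w]).
    by apply: bigU => n; exists c, (- n%:R).
  apply/seteqP; split => w /=; last by case=> n _ [].
  by move=> cX; have [n nM] := exn (M w); exists n.
- rewrite (_ : [set _ | _] = \bigcup_n [set w | - n%:R < X w /\ c < M w]).
    by apply: bigU => n; exists (- n%:R), c.
  apply/seteqP; split => w /=; last by case=> n _ [].
  by move=> cM; have [n nX] := exn (X w); exists n.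
Qed.

(** Products of two ramps are bounded and continuous and tend to the indicators of quadrants, with
    [|f|] as dominating function; Dynkin's lemma does the rest. *)
Lemma orthogonal_rays (P : probability Omega R) (f : Omega -> R) :
  P.-integrable setT (EFin \o f) ->
  (forall phi : R -> R -> R, continuous (fun p : R * R => phi p.1 p.2) ->
    (exists C, forall x m, `|phi x m| <= C) ->
    (\int[P]_w (phi (X w) (M w) * f w)%:E = 0)%E) ->
  forall A, <<s rays >> A -> (\int[P]_(w in A) (f w)%:E = 0)%E.
Proof.
move=> iF f0.
have sub A : <<s rays >> A -> measurable A by exact: ray_sigma_algebra.2.
have fT : (\int[P]_w (f w)%:E = 0)%E.
  rewrite -[RHS](f0 (fun _ _ => 1)).
  - by apply: eq_integral => w _; rewrite mul1r.
  - exact: continuous_cst.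
  - by exists 1 => _ _; rewrite normr1.
apply: (@dynkin_induction _ (g_sigma_algebraType rays) rays) => //.
- exact: raysI.
- move=> _ [a [b ->]].
  have rA : measurable [set w | a < X w /\ b < M w] by apply: rays_measurable; exists a, b.
  have mr n c (Z : Omega -> R) : measurable_fun setT Z ->
      measurable_fun setT (fun w => ramp n c (Z w)).
    move=> mZ; apply: measurableT_comp => //; apply: continuous_measurable.
    exact: continuous_ramp.
  have h : (\int[P]_w (ramp n a (X w) * ramp n b (M w) * f w)%:E @[n --> \oo] -->
      \int[P]_(w in [set w | (a < X w)%R /\ (b < M w)%R]) (f w)%:E)%E.
    apply: integral_indic_cvg => //.
    + by move=> n; apply: measurable_funM; exact: mr.
    + by move=> n w; rewrite normrM mulr_ile1// ramp_norm_le1.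
    + move=> w; rewrite indicE (_ : (w \in _) = (a < X w) && (b < M w)).
        by rewrite -mulnb natrM; apply: cvgM; exact: ramp_cvg.
      by apply/idP/idP; rewrite inE => /andP.
  have h0 n : (\int[P]_w (ramp n a (X w) * ramp n b (M w) * f w)%:E = 0)%E.
    apply: (f0 (fun x m => ramp n a x * ramp n b m)).
    + move=> p; apply: cvgM.
        by apply: (@continuous_comp _ _ _ fst (ramp n a)); [exact: cvg_fst|exact: continuous_ramp].
      by apply: (@continuous_comp _ _ _ snd (ramp n b)); [exact: cvg_snd|exact: continuous_ramp].
    + by exists 1 => x m; rewrite normrM mulr_ile1// ramp_norm_le1.
  move: h; under [X in X @ _ --> _]funext => n do rewrite h0.
  by move=> h; apply: (cvg_unique _ h); [|exact: cvg_cst].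
- move=> S mS S0; have sS := sub _ mS.
  have := @integral_setU _ _ _ P S (~` S) (EFin \o f) sS (measurableC sS).
  rewrite setUv fT S0 add0e => <- //.
    by case/integrableP: iF.
  by apply/disj_setPS; rewrite setICr.
- move=> F mF tF F0; rewrite integral_bigcup//.
  + by apply: eseries0 => i _ _; exact: F0.
  + by move=> k; apply: sub; exact: mF.
  + apply: (integrableS measurableT) => //; apply: bigcup_measurable => k _.
    by apply: sub; exact: mF.
Qed.

End ray_algebra.

(** * The atom of the conditional law at its maximum *)

Section bias.
Context {R : realType} d {Omega : measurableType d} (P : probability Omega R).

(** Positive mass puts [m] in the support and the null ray makes [m] an upper bound of it, so
    [max_supp rho] is the singleton of [m]. *)
Lemma atom_biased (rho : {measure set R -> \bar R}) (beta m : R) : 0 < beta ->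
  (beta%:E <= rho [set m])%E -> rho `]m, +oo[%classic = 0%E -> biased beta rho.
Proof.
move=> b0 bm m0; suff -> : biased beta rho = (beta%:E <= rho [set m])%E by [].
rewrite /biased; congr (_ <= rho _)%E.
have um : ubound (supp rho) m.
  move=> y sy; rewrite leNgt; apply/negP => my.
  have oy : open_nbhs y `]m, +oo[%classic.
    by split; [exact: interval_open|rewrite /= in_itv/= my].
  by have := sy _ oy; rewrite m0 ltxx.
have sm : supp rho m.
  move=> U [oU Um]; apply: (@lt_le_trans _ _ beta%:E); first by rewrite lte_fin.
  apply: (le_trans bm); apply: le_measure; rewrite ?inE//; first exact: open_measurable.
  by move=> _ ->.
apply/seteqP; split => [z [sz uz]|_ ->//].
by apply/eqP; rewrite eq_le um// uz.
Qed.

Lemma eq_integral_sub0 (A : set Omega) (f g : Omega -> R) : measurable A ->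
  P.-integrable setT (EFin \o f) -> P.-integrable setT (EFin \o g) ->
  (\int[P]_(w in A) (f w - g w)%:E = 0)%E ->
  (\int[P]_(w in A) (f w)%:E = \int[P]_(w in A) (g w)%:E)%E.
Proof.
move=> mA iF iG.
have iFA : P.-integrable A (EFin \o f) by exact: integrableS iF.
have iGA : P.-integrable A (EFin \o g) by exact: integrableS iG.
have fF := integrable_fin_num mA iFA; have fG := integrable_fin_num mA iGA.
rewrite integralB_EFin// -(fineK fF) -(fineK fG) -EFinB => -[/eqP].
by rewrite subr_eq0 => /eqP ->.
Qed.

Lemma ae_notin (N : set Omega) (f : Omega -> R) : measurable N ->
  measurable_fun N f -> (forall w, N w -> 0 < f w) ->
  (\int[P]_(w in N) (f w)%:E <= 0)%E -> {ae P, forall w, ~ N w}.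
Proof.
move=> mN mf f0 If.
have /(ae_eq_integral_abs P mN) h := (measurable_EFinP _ _).2 mf.
have /h : (\int[P]_(w in N) `|(f w)%:E| = 0)%E.
  apply/eqP; rewrite eq_le integral_ge0 ?andbT//; apply: le_trans If.
  by under eq_integral => w /[!inE] Nw do rewrite /= gtr0_norm ?f0//.
apply: filterS => w fw Nw; have [fw0] := fw Nw.
by have := f0 w Nw; rewrite fw0 ltxx.
Qed.

Variables (F : set (set Omega)) (sF : Defs.sub_sigma_algebra F).
Variables (M Y e : Omega -> R) (beta : R) (k : R.-pker (g_sigma_algebraType F) ~> R).
Hypotheses (MF : measurable_wrt F M) (mY : measurable_fun setT Y).
Hypotheses (ie : P.-integrable setT (EFin \o e)) (beta_gt0 : 0 < beta).
Hypothesis kY : is_cond_law P Y k.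
Hypothesis e_beta : forall A, F A ->
  (\int[P]_(w in A) (e w)%:E = \int[P]_(w in A) beta%:E)%E.
Hypothesis MYe : {ae P, forall w, admissible beta (M w) (Y w) (e w)}.

Let mF A : F A -> measurable A. Proof. exact: sF.2. Qed.

Let FE := sub_sigma_algebraE sF.

Let F_gt q : F [set w | q < M w].
Proof.
rewrite -FE (_ : [set _ | _] = setT `&` M @^-1` `]q, +oo[); first exact: MF.
by rewrite setTI; apply/seteqP; split => w /=; rewrite in_itv/= andbT.
Qed.

Let k_le1 w B : measurable B -> (k w B <= 1)%E.
Proof.
by move=> mB; rewrite -(prob_kernel (s := k) w); apply: le_measure; rewrite ?inE.
Qed.

Let kq q (w : Omega) : R := fine (k w `]q, +oo[%classic).

Let kqE q w : k w `]q, +oo[%classic = (kq q w)%:E.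
Proof. by rewrite fineK// ge0_fin_numE//; apply: le_lt_trans (k_le1 _ _) _; rewrite ?ltry. Qed.

Let kq_wrt q : measurable_wrt F (kq q).
Proof.
apply: measurableT_comp => //; exact: measurable_kernel.
Qed.

Let mkq q : measurable_fun setT (kq q).
Proof. exact: (measurable_wrt_measurable sF (kq_wrt q)). Qed.

Let integral_kq q A : F A ->
  (\int[P]_(w in A) (kq q w)%:E = P (A `&` Y @^-1` `]q, +oo[))%E.
Proof.
by move=> FA; rewrite kY//; apply: eq_integral => w _; rewrite kqE.
Qed.

Let ikq q : P.-integrable setT (EFin \o kq q).
Proof.
apply/integrableP; split; first exact/measurable_EFinP.
apply: (@le_lt_trans _ _ (\int[P]_w 1)%E); last first.
  rewrite integral_cst// mul1e.
  by apply: (le_lt_trans (probability_le1 P measurableT)); rewrite ltry.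
apply: ge0_le_integral => //.
  by apply/measurable_EFinP; apply: measurableT_comp.
by move=> w _; rewrite /= ger0_norm ?fine_ge0// -kqE k_le1.
Qed.

(** Where [q < M], a nonzero [e] forces [Y = M > q], so [e] is at most the indicator of [Y > q].
    Integrating over the [F]-set [N] where the bound fails shows that [N] is null. *)
Let gt_kq q : {ae P, forall w, q < M w -> beta <= kq q w}.
Proof.
pose N := [set w | q < M w] `&` [set w | kq q w < beta].
have FN : F N.
  rewrite -FE; apply: measurableI; first by rewrite FE; exact: F_gt.
  rewrite (_ : [set _ | _] = setT `&` kq q @^-1` `]-oo, beta[); first exact: kq_wrt.
  by rewrite setTI; apply/seteqP; split => w /=; rewrite in_itv.
have mN := mF FN.
have mYq : measurable (Y @^-1` `]q, +oo[) by rewrite -[X in measurable X]setTI; exact: mY.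
suff : {ae P, forall w, ~ N w}.
  by apply: filterS => w Nw qM; rewrite leNgt; apply/negP => kb; apply: Nw.
apply: (@ae_notin N (fun w => beta - kq q w)) => //.
- by apply: measurable_funB => //; exact: measurable_funTS.
- by move=> w [_ /= kb]; rewrite subr_gt0.
rewrite (@integralB_EFin _ _ _ P N (fun=> beta) (kq q))//; last 2 first.
- by apply: finite_measure_integrable_cst.
- by apply: integrableS (ikq q).
rewrite leeBlDr ?add0e; last exact: integrable_fin_num (integrableS _ _ _ (ikq q)).
rewrite -e_beta// integral_kq//.
apply: (@le_trans _ _ (\int[P]_(w in N) (\1_(Y @^-1` `]q, +oo[) w)%:E)%E); last first.
  by rewrite integral_indic// setIC.
rewrite [leLHS]integral_mkcond [leRHS]integral_mkcond.
have me : measurable_fun setT e by apply/measurable_EFinP; case/integrableP: ie.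
apply: integral_le_ae.
- apply/(measurable_restrictT _ mN)/measurable_EFinP; exact: measurable_funTS.
- by apply/(measurable_restrictT _ mN)/measurable_EFinP.
apply: filterS MYe => w; rewrite /admissible beta_gt0 => -[YM /andP[e0 e1] eMY].
rewrite !patchE; case: ifPn => // /[!inE] -[/= qM _]; rewrite lee_fin indicE.
move/eqP: eMY; rewrite mulf_eq0 => /orP[/eqP ->//|]; rewrite subr_eq0 => /eqP MY.
by rewrite mem_set//= in_itv/= andbT -MY.
Qed.

(** Where [M <= q], the constraint [Y <= M] excludes [Y > q], and that event lies in [F]. *)
Let le_kq q : {ae P, forall w, M w <= q -> kq q w = 0}.
Proof.
pose N := ~` [set w | q < M w].
have FN : F N by rewrite -FE; apply: measurableC; rewrite FE; exact: F_gt.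
have mN := mF FN.
have mYq : measurable (Y @^-1` `]q, +oo[) by rewrite -[X in measurable X]setTI; exact: mY.
have k0 w : 0 <= kq q w by apply: fine_ge0.
have : (\int[P]_(w in N) `|(kq q w)%:E| = 0)%E.
  under eq_integral do rewrite /= ger0_norm//.
  rewrite integral_kq//; apply/negligibleP; first exact: measurableI.
  apply: negligibleS MYe => w [/= qM]; rewrite in_itv/= andbT => qY.
  rewrite /admissible beta_gt0 => -[YM _ _]; apply: qM.
  exact: lt_le_trans YM.
have /(ae_eq_integral_abs P mN) h : measurable_fun N (EFin \o kq q).
  by apply/measurable_EFinP; exact: measurable_funTS.
move=> /h; apply: filterS => w kw Mq.
have Nw : N w by move=> /=; apply/negP; rewrite -leNgt.
by case: (kw Nw).
Qed.

(** Rational thresholds keep the exceptional sets countable in number. Those above [M w] show that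
    [k w] has no mass beyond [M w]; those increasing to [M w] leave mass at least [beta] on the
    closed ray from [M w], hence on the point [M w]. *)
Lemma biased_cond_law : {ae P, forall w, biased beta (k w)}.
Proof.
have aeQ (Q : rat -> Omega -> Prop) : (forall q, {ae P, forall w, Q q w}) ->
    {ae P, forall w, forall q, Q q w}.
  move=> aeQ.
  have : {ae P, forall w (n : nat), if unpickle n is Some q then Q q w else True}.
    apply: ae_foralln => n; case: unpickle => [q|]; first exact: aeQ.
    exact: nearW.
  by apply: filterS => w h q; have := h (pickle q); rewrite pickleK.
apply: filterS2 (aeQ _ (fun q => gt_kq (ratr q))) (aeQ _ (fun q => le_kq (ratr q))).
move=> w gtq leq.
have M0 : k w `]M w, +oo[%classic = 0%E.
  have N0 n : (k w).-negligible
      (if unpickle n is Some q then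
         if M w <= ratr (q : rat) then `]ratr q, +oo[%classic else set0 else set0).
    case: unpickle => [q|]; last exact: negligible_set0.
    case: ifPn => [Mq|_]; last exact: negligible_set0.
    have : k w `]ratr q, +oo[%classic = 0%E by rewrite kqE leq.
    by move=> k0; apply/negligibleP => //; exact: measurable_itv.
  have : (k w).-negligible `]M w, +oo[%classic.
    apply: negligibleS (negligible_bigcup N0) => y /=; rewrite in_itv/= andbT => My.
    have [q] := rat_in_itvoo My; rewrite in_itv/= => /andP[Mq qy].
    exists (pickle q); first exact: I.
    by rewrite pickleK (ltW Mq)/= in_itv/= qy.
  by move/negligibleP => ->.
apply: (@atom_biased _ beta (M w)) => //.
pose B n := `]M w - n.+1%:R^-1, +oo[%classic : set R.
have mB n : measurable (B n) by exact: measurable_itv.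
have kB : (k w (B n) @[n --> \oo] --> k w (\bigcap_n B n))%E.
  apply: nonincreasing_cvg_mu => //.
  - by apply: (@le_lt_trans _ _ 1%E); [exact: k_le1|rewrite ltry].
  - exact: bigcapT_measurable.
  - move=> m n mn; apply/subsetPset => y; rewrite /B/= !in_itv/= !andbT.
    by apply: le_lt_trans; rewrite lerD2l lerN2 lef_pV2 ?posrE// ler_nat.
have bB n : (beta%:E <= k w (B n))%E.
  have [q] : exists q : rat, ratr q \in `](M w - n.+1%:R^-1), M w[.
    by apply: rat_in_itvoo; rewrite gtrBl invr_gt0.
  rewrite in_itv/= => /andP[qn qM]; apply: (@le_trans _ _ (k w `]ratr q, +oo[%classic)).
    by rewrite kqE lee_fin gtq.
  apply: le_measure; rewrite ?inE//= => y; rewrite /B/= !in_itv/= !andbT.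
  exact: lt_trans.
have : (beta%:E <= k w (\bigcap_n B n))%E.
  by apply: (cvge_to_ge kB); exact: nearW.
move=> /le_trans; apply; rewrite -[leRHS]adde0 -M0 -measureU//.
- apply: le_measure; rewrite ?inE//; first exact: bigcapT_measurable.
    exact: measurableU.
  move=> y By /=; rewrite in_itv/= andbT.
  suff : M w <= y by rewrite le_eqVlt => /predU1P[->|]; [left|right].
  apply/ler_addgt0Pr => z z0.
  have [n _ /(_ n (leqnn n))/= /ltW nz] := near_infty_natSinv_lt (PosNum z0).
  have := By n I; rewrite /B/= in_itv/= andbT => /ltW; rewrite lerBlDr => /le_trans; apply.
  by rewrite lerD2l.
- by apply/seteqP; split => // y /= [->]; rewrite in_itv/= ltxx.
Qed.

End bias.

(** * From the order to a biased martingale *)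

Lemma linearly_bounded_bounded (R : realType) (g : R -> R) :
  (forall x, `|g x| <= 1) -> linearly_bounded g.
Proof.
by move=> g1; exists 1 => // x; rewrite mul1r (le_trans (g1 x))// lerDl.
Qed.

Lemma biased_le_Cpl (R : realType) (mu nu : probability R R) (beta : R) :
  finite_first_moment mu -> finite_first_moment nu -> 0 <= beta ->
  biased_le beta mu nu -> Cpl beta mu nu !=set0.
Proof.
move=> mu1 nu1 b0 munu.
have [L [linL L_le]] := dual_functional mu1 nu1 b0 munu.
have := martingale_space mu1 nu1 b0 linL L_le.
move=> -[]d -[]Omega -[P [X [M [Y [e [[mM iX iY ie] law orth MYe]]]]]].
have mX : measurable_fun setT X by apply/measurable_EFinP; case/integrableP: iX.
have mY : measurable_fun setT Y by apply/measurable_EFinP; case/integrableP: iY.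
have ib : P.-integrable setT (EFin \o fun=> beta) by exact: finite_measure_integrable_cst.
(* The initial sigma-algebra must know [M]: given [X] alone, the law of [Y] is a mixture over the
   values of [M], and the bias could be lost. *)
pose F := <<s rays X M>>.
have sF : Defs.sub_sigma_algebra F := ray_sigma_algebra mX mM.
have [XF MF] := measurable_wrt_rays mX mM.
have YX A : F A -> (\int[P]_(w in A) (Y w)%:E = \int[P]_(w in A) (X w)%:E)%E.
  move=> FA; apply: eq_integral_sub0 => //; first exact: sF.2.
  apply: (orthogonal_rays mX mM _ _ FA); first exact: (integrableB measurableT iY iX).
  by move=> phi cphi bphi; have [] := orth phi cphi bphi.
have eb A : F A -> (\int[P]_(w in A) (e w)%:E = \int[P]_(w in A) beta%:E)%E.
  move=> FA; apply: eq_integral_sub0 => //; first exact: sF.2.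
  apply: (orthogonal_rays mX mM _ _ FA); first exact: (integrableB measurableT ie ib).
  by move=> phi cphi bphi; have [] := orth phi cphi bphi.
have [k kY] := regular_cond_law P sF mY.
have sA : Defs.sub_sigma_algebra (measurable : set (set Omega)).
  by split => //; exact: sigma_algebra_measurable.
pose Z w := (X w, Y w).
have mZ : measurable_fun setT Z by exact: measurable_fun_pair.
pose Zm : {mfun Omega >-> (R * R)%type} := HB.pack Z (isMeasurableFun.Build _ _ _ _ Z mZ).
have lb n c := @linearly_bounded_bounded R (ramp n c) (ramp_norm_le1 n c).
exists (distribution P Zm), d, Omega, P, F, measurable, X, Y; split.
- split; last first.
    exists k => //; have [beta0|] := ltP 0 beta.
      exact: (biased_cond_law sF MF mY ie beta0 kY eb MYe).
    move=> beta0; apply: nearW => w; rewrite /biased.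
    by apply: (@le_trans _ _ 0%E); [rewrite lee_fin|exact: measure_ge0].
  split => //.
  + exact: sF.2.
  + by rewrite /measurable_wrt => _ B mB; rewrite (sub_sigma_algebraE sA); exact: mY.
  + by split => // A /YX.
- by apply: has_law_ramp => // n c; exact: (law _ (@continuous_ramp R n c) (lb n c)).1.
- by apply: has_law_ramp => // n c; exact: (law _ (@continuous_ramp R n c) (lb n c)).2.
- by [].
Qed.

Theorem theorem1p1 (R : realType) (mu nu : probability R R) (beta : R)
  (mu_P1 : finite_first_moment mu) (nu_P1 : finite_first_moment nu)
  (beta_ge0 : 0 <= beta) (beta_lt1 : beta < 1) :
  Cpl beta mu nu !=set0 <-> biased_le beta mu nu.
Proof.
split; first exact: Cpl_biased_le.
exact: biased_le_Cpl.
Qed.
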